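(* Let $a,b\in L^\infty$ satisfy the standing assumption on symbol pairs, and let $\eta\in L^\infty$. Then: (i) $\ker S_{a,b}\cap(\ker H_\eta\oplus\ker\widetilde H_\eta)$ is stable in $\ker S_{a,b}$ for multiplication by $\eta$; that is, for $f\in L^2$ with $f_\pm=P^\pm f$, $$f\in\ker S_{a,b},\quad H_\eta f_+=0,\quad \widetilde H_\eta f_-=0\ \Longrightarrow\ \eta f\in\ker S_{a,b}.$$ (ii) If $f\in\ker\Sigma_{a,b}$ and $(a-b)f\in\ker H_\eta\oplus\ker\widetilde H_\eta$, then $\eta f\in\ker\Sigma_{a,b}$.
   Context: $\mathbb T$ is the unit circle, $L^2=L^2(\mathbb T)$, $L^\infty=L^\infty(\mathbb T)$; $H^2_+=H^2(\mathbb D)$ is the Hardy space regarded as a closed subspace of $L^2$ via boundary values, $H^2_-=(H^2_+)^\perp$ in $L^2$, and $P^\pm$ are the orthogonal projections of $L^2$ onto $H^2_\pm$. For $a,b\in L^\infty$ the bounded operators $S_{a,b},\Sigma_{a,b}$ on $L^2$ are $S_{a,b}f=aP^+f+bP^-f$ and $\Sigma_{a,b}f=P^+(af)+P^-(bf)$. Standing assumption on a symbol pair $(a,b)$: $a\neq0$ a.e. and $b\neq 0$ a.e. on $\mathbb T$, and either $a=b$ or $a-b\neq0$ a.e. on $\mathbb T$. The Hankel operators are $H_\eta:H^2_+\to H^2_-$, $H_\eta f=P^-(\eta f)$, and $\widetilde H_\eta:H^2_-\to H^2_+$, $\widetilde H_\eta f=P^+(\eta f)$. A subspace $\mathcal A$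 contained in a subspace $\mathcal N$ of $L^2$ is said to be stable in $\mathcal N$ for an operator $X$ if $X(\mathcal A)\subset\mathcal N$. *)

(* Defs.v *)
From HB Require Import structures.
From mathcomp Require Import all_boot all_order all_algebra.
From mathcomp Require Import all_classical all_reals all_analysis.
From mathcomp Require Import complex.

Set Implicit Arguments.
Unset Strict Implicit.
Unset Printing Implicit Defensive.

Import Order.TTheory GRing.Theory Num.Theory.
Import numFieldNormedType.Exports.
Import ComplexField.Normc.

Local Open Scope classical_set_scope.
Local Open Scope ring_scope.
Local Open Scope complex_scope.

Lemma two_pi_gt0 (R : realType) : (0 : R) < pi *+ 2.
Proof. by rewrite mulrn_wgt0 ?pi_gt0. Qed.

(* A function on the unit circle is represented by f : R -> R[i], where f t is
   its value at e^{it} for t in [0, 2 pi]; the values of f outside [0, 2 pi]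
   are irrelevant, because they lie on a null set of [arc_measure R], the normalized
   arc length measure. Functions are identified up to equality a.e. *)
Definition arc_measure (R : realType) : probability (measurableTypeR R) R :=
  uniform_prob (two_pi_gt0 R).

Section CircleSpaces.
Variable R : realType.
Local Notation C := R[i].
Implicit Types (a b eta f g h : R -> C) (F : C -> C).

Definition cexp (t : R) : C := cos t +i* sin t.

Definition cnorm (p : \bar R) f : \bar R :=
  Lnorm (arc_measure R) p (fun t => (normc (f t))%:E).

Definition Lp (p : \bar R) : set (R -> C) := [set f |
  [/\ measurable_fun [set: measurableTypeR R] (fun t => complex.Re (f t)),
      measurable_fun [set: measurableTypeR R] (fun t => complex.Im (f t)) &
      (cnorm p f < +oo)%E]].

Definition L2 : set (R -> C) := Lp 2%:E.
Definition Linfty : set (R -> C) := Lp +oo%E.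

Definition inner f g : C :=
  Rintegral (arc_measure R) setT (fun t => complex.Re (f t * (g t)^*)) +i*
  Rintegral (arc_measure R) setT (fun t => complex.Im (f t * (g t)^*)).

Definition analytic_disc F : Prop := exists c : nat -> C, forall z : C,
  normc z < 1 ->
  series (fun n => c n * z ^+ n : C^o) @ \oo --> (F z : C^o).

Definition radial F (r : R) : R -> C := fun t => F (r%:C * cexp t).

Definition hardy_disc : set (C -> C) := [set F | analytic_disc F /\
  exists M : R, forall r : R, 0 <= r < 1 -> (cnorm 2%:E (radial F r) <= M%:E)%E].

(* The boundary function of F in H^2(D) is the limit in L^2 of its dilates
   e^{it} |-> F (r e^{it}) as r tends to 1 from below. *)
Definition boundary_value F f : Prop :=
  cnorm 2%:E (fun t => radial F r t - f t) @[r --> (1 : R)^'-] --> 0%E.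

Definition Hplus : set (R -> C) := [set f |
  L2 f /\ exists2 F, hardy_disc F & boundary_value F f].

Definition Hminus : set (R -> C) := [set g |
  L2 g /\ forall h, Hplus h -> inner g h = 0].

(* A representative, determined up to equality a.e., of the orthogonal
   projection of f onto V; the default value 0 is not used for f in L2 and V a
   closed subspace. *)
Definition orthproj (V : set (R -> C)) f : R -> C :=
  xget (fun=> 0) [set g | V g /\ forall h, V h -> inner (f \- g) h = 0].

Definition Pplus f : R -> C := orthproj Hplus f.
Definition Pminus f : R -> C := orthproj Hminus f.

Definition Sop a b f : R -> C := (a \* Pplus f) \+ (b \* Pminus f).
Definition Sigmaop a b f : R -> C := Pplus (a \* f) \+ Pminus (b \* f).
Definition hankel eta f : R -> C := Pminus (eta \* f).
Definition hankelt eta f : R -> C := Pplus (eta \* f).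

Definition ker_on (D : set (R -> C)) (X : (R -> C) -> (R -> C)) :
  set (R -> C) := [set f | D f /\ X f = (fun=> 0) %[ae arc_measure R]].

Definition kerS a b := ker_on L2 (Sop a b).
Definition kerSigma a b := ker_on L2 (Sigmaop a b).
Definition kerH eta := ker_on Hplus (hankel eta).
Definition kerHt eta := ker_on Hminus (hankelt eta).

(* For A contained in Hplus and B in Hminus the sum is automatically direct. *)
Definition sumL2 (A B : set (R -> C)) : set (R -> C) := [set f |
  L2 f /\ exists u v, [/\ A u, B v & f = u \+ v %[ae arc_measure R]]].

Definition stable_in (N A : set (R -> C)) (X : (R -> C) -> (R -> C)) : Prop :=
  A `<=` N /\ [set X f | f in A] `<=` N.

Definition symbol_pair a b : Prop :=
  [/\ {ae arc_measure R, forall t, a t != 0},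
      {ae arc_measure R, forall t, b t != 0} &
      a = b %[ae arc_measure R] \/ {ae arc_measure R, forall t, a t - b t != 0}].

End CircleSpaces.

(* Main.v *)
Require Import Defs.
From mathcomp Require Import all_boot all_order all_algebra.
From mathcomp Require Import all_classical all_reals all_analysis.
From mathcomp Require Import measurable_realfun ess_sup_inf.
From mathcomp Require Import complex ring lra.

(* Everything reduces to the existence of the orthogonal projection onto H^2_+:
   then P^- g = 0 iff g _|_ H^2_-, and P^+ g = 0 iff g is in H^2_-. In (i) this
   makes eta f = eta f_+ + eta f_- the decomposition of eta f, so that
   S_{a,b} (eta f) = eta S_{a,b} f = 0. In (ii), Sigma_{a,b} f = 0 forces
   P^+ (a f) = P^- (b f) = 0; if (a - b) f = u + v then a f - v = b f + u lies in
   H^2_- and is orthogonal to it, whence a f = v and b f = - u.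

   To project f onto H^2_+, let c n be its Fourier coefficients, n >= 0. Bessel's
   inequality and Riesz-Fischer give an L^2-limit g of sum_(k < n) c k e^{ikt},
   the dilates of F z = sum_n c n z^n tend to g, and f - g is orthogonal to
   every e^{int}, n >= 0; every element of H^2_+ is an L^2-limit of dilates,
   which are themselves uniform limits of polynomials in e^{it}. *)

Set Implicit Arguments.
Unset Strict Implicit.
Unset Printing Implicit Defensive.
Import Order.TTheory GRing.Theory Num.Theory.
Import numFieldNormedType.Exports.
Import ComplexField.Normc.
Local Open Scope classical_set_scope.
Local Open Scope ring_scope.
Local Open Scope complex_scope.

(** * Real square-integrable functions *)

Section SquareIntegrableReal.
Context d (T : measurableType d) (R : realType).
Variable mu : {measure set T -> \bar R}.
Implicit Types u v w : T -> R.

Definition sqint u : Prop :=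
  measurable_fun setT u /\ mu.-integrable setT (EFin \o (fun t => u t ^+ 2)).

(** By domination: [|u t * v t|] is at most [u t ^+ 2 + v t ^+ 2]. *)
Lemma sqint_mul u v : sqint u -> sqint v ->
  mu.-integrable setT (EFin \o (fun t => u t * v t)).
Proof.
move=> [mu_ iu] [mv iv].
apply: (le_integrable _ _ _ (integrableD _ iu iv)) => //.
  by apply/measurable_EFinP; exact: measurable_funM.
move=> t _; rewrite /= lee_fin [leRHS]ger0_norm ?addr_ge0 ?sqr_ge0//.
by rewrite ler_norml; apply/andP; split; nra.
Qed.

(** Three summands, because for complex [c] the real and the imaginary part of [f + c * g] both have
    this shape. *)
Lemma sqint_lincomb (p q : R) u v w : sqint u -> sqint v -> sqint w ->
  sqint (fun t => u t + p * v t + q * w t).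
Proof.
move=> [mu_ iu] [mv iv] [mw iw].
have m : measurable_fun setT (fun t => u t + p * v t + q * w t).
  by do 2?apply: measurable_funD => //; apply: measurable_funM.
split=> //.
(* The dominating function comes from [(x + y + z)^2 <= 3 (x^2 + y^2 + z^2)]; the gap is the sum of
   the squares of the pairwise differences, which are handed to [nra] below. *)
have := integrableZl measurableT 3 (integrableD measurableT (integrableD measurableT iu
  (integrableZl measurableT (p ^+ 2) iv)) (integrableZl measurableT (q ^+ 2) iw)).
apply: le_integrable => //.
  by apply/measurable_EFinP; exact: measurable_funX.
move=> t _; rewrite /= lee_fin ger0_norm ?sqr_ge0//.
rewrite ger0_norm; last first.
  by apply: mulr_ge0; [exact: ler0n|rewrite -!exprMn !addr_ge0 ?sqr_ge0].
have := sqr_ge0 (u t - p * v t); have := sqr_ge0 (u t - q * w t).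
have := sqr_ge0 (p * v t - q * w t); nra.
Qed.

Lemma Rintegral_lincomb (p q : R) u v w z :
  sqint u -> sqint v -> sqint w -> sqint z ->
  Rintegral mu setT (fun t => (u t + p * v t + q * w t) * z t) =
  Rintegral mu setT (fun t => u t * z t) +
  p * Rintegral mu setT (fun t => v t * z t) +
  q * Rintegral mu setT (fun t => w t * z t).
Proof.
move=> su sv sw sz.
have iu := sqint_mul su sz; have iv := sqint_mul sv sz; have iw := sqint_mul sw sz.
rewrite -!RintegralZl//.
have iv' := integrableZl measurableT p iv.
have iw' := integrableZl measurableT q iw.
rewrite -!RintegralD//; last exact: (integrableD _ iu iv').
by apply: eq_Rintegral => t _; ring.
Qed.

End SquareIntegrableReal.

(** * The inner product and the norm of complex L^2 *)

Section SquareIntegrable.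
Variable R : realType.
Local Notation C := R[i].
Local Notation mu := (arc_measure R).
Local Notation J := (Rintegral mu setT).
Local Notation Re := complex.Re.
Local Notation Im := complex.Im.
Implicit Types (f g h : R -> C).

(** The squared L^2 norm as a real number. [Rintegral] sends an infinite integral to 0, so the value
    is meaningful for [f] in [L2], where [L2_nsqE] applies. *)
Definition nsq f : R := J (fun t => Re (f t) ^+ 2 + Im (f t) ^+ 2).

Lemma normc_sqr (z : C) : normc z ^+ 2 = Re z ^+ 2 + Im z ^+ 2.
Proof. by case: z => a b; rewrite /= sqr_sqrtr// addr_ge0 ?sqr_ge0. Qed.

Lemma normc_ge0 (z : C) : 0 <= normc z.
Proof. by case: z => a b; exact: sqrtr_ge0. Qed.

Lemma normcR (x : R) : normc x%:C = `|x|.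
Proof. by rewrite /= expr0n addr0 sqrtr_sqr. Qed.

Lemma normc_ge_normRe (z : C) : `|Re z| <= normc z.
Proof. by case: z => x y /=; rewrite -sqrtr_sqr ler_wsqrtr// lerDl sqr_ge0. Qed.

Lemma normc_ge_normIm (z : C) : `|Im z| <= normc z.
Proof. by case: z => x y /=; rewrite -sqrtr_sqr ler_wsqrtr// lerDr sqr_ge0. Qed.

Lemma cnorm2E f : cnorm 2%:E f =
  ((\int[mu]_t (Re (f t) ^+ 2 + Im (f t) ^+ 2)%:E) `^ 2^-1)%E.
Proof.
rewrite /cnorm unlock; congr (_ `^ _)%E; apply: eq_integral => t _.
by rewrite /= ger0_norm ?normc_ge0// powR_mulrn ?normc_ge0// normc_sqr.
Qed.

Lemma L2P f : L2 f <-> sqint mu (fun t => Re (f t)) /\ sqint mu (fun t => Im (f t)).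
Proof.
split.
- move=> [mr mi]; rewrite -/(cnorm _ _) cnorm2E => /lty_poweRy.
  move=> /(_ _)/wrap[]; first by rewrite invr_neq0.
  move=> fin.
  have i : mu.-integrable setT (EFin \o (fun t => Re (f t) ^+ 2 + Im (f t) ^+ 2)).
    apply/integrableP; split.
      by apply/measurable_EFinP; apply: measurable_funD; exact: measurable_funX.
    rewrite (eq_integral (fun t : measurableTypeR R => (Re (f t) ^+ 2 + Im (f t) ^+ 2)%:E))//.
    by move=> t _; rewrite /= ger0_norm// addr_ge0 ?sqr_ge0.
  split; split => //; apply: le_integrable i => //.
  + by apply/measurable_EFinP; exact: measurable_funX.
  + move=> t _; rewrite /= lee_fin !ger0_norm ?addr_ge0 ?sqr_ge0//.
    by rewrite lerDl sqr_ge0.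
  + by apply/measurable_EFinP; exact: measurable_funX.
  + move=> t _; rewrite /= lee_fin !ger0_norm ?addr_ge0 ?sqr_ge0//.
    by rewrite lerDr sqr_ge0.
- move=> [[mr ir] [mi ii]]; split=> //.
  rewrite cnorm2E poweR_lty//.
  have /integrableP[_] := integrableD measurableT ir ii.
  rewrite (eq_integral (fun t : measurableTypeR R => (Re (f t) ^+ 2 + Im (f t) ^+ 2)%:E))//.
  by move=> t _; rewrite /= ger0_norm// addr_ge0 ?sqr_ge0.
Qed.

Lemma L2_integrable f : L2 f ->
  mu.-integrable setT (EFin \o (fun t => Re (f t) ^+ 2 + Im (f t) ^+ 2)).
Proof. by move=> /L2P[[mr ir] [mi ii]]; exact: (integrableD _ ir ii). Qed.

Lemma nsq_ge0 f : 0 <= nsq f.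
Proof. by apply: Rintegral_ge0 => t _; rewrite addr_ge0 ?sqr_ge0. Qed.

Lemma L2_nsqE f : L2 f ->
  (\int[mu]_t (Re (f t) ^+ 2 + Im (f t) ^+ 2)%:E)%E = (nsq f)%:E.
Proof.
by move=> /L2_integrable lf; rewrite /nsq /Rintegral fineK//; exact: integrable_fin_num.
Qed.

Lemma L2_cnormE f : L2 f -> cnorm 2%:E f = (Num.sqrt (nsq f))%:E.
Proof.
by move=> lf; rewrite cnorm2E L2_nsqE// poweR_EFin powR12_sqrt// nsq_ge0.
Qed.

Lemma L2_lincomb f g (c : C) : L2 f -> L2 g -> L2 (fun t => f t + c * g t).
Proof.
move=> /L2P[fr fi] /L2P[gr gi]; apply/L2P; split.
- have := sqint_lincomb (Re c) (- Im c) fr gr gi; congr sqint; apply/funext => t.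
  by case: c (f t) (g t) => [? ?] [? ?] [? ?] /=; ring.
- have := sqint_lincomb (Im c) (Re c) fi gr gi; congr sqint; apply/funext => t.
  by case: c (f t) (g t) => [? ?] [? ?] [? ?] /=; ring.
Qed.

(** Splits the inner product into four real integrals, each finite by [sqint_mul], so that linearity
    can be inherited from [Rintegral_lincomb]. *)
Lemma innerE f g : L2 f -> L2 g -> inner f g =
  (J (fun t => Re (f t) * Re (g t)) + J (fun t => Im (f t) * Im (g t))) +i*
  (J (fun t => Im (f t) * Re (g t)) - J (fun t => Re (f t) * Im (g t))).
Proof.
move=> /L2P[fr fi] /L2P[gr gi]; rewrite /inner.
rewrite -RintegralD//; try exact: sqint_mul.
rewrite -RintegralB//; try exact: sqint_mul.
congr (_ +i* _); apply: eq_Rintegral => t _;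
  by case: (f t) (g t) => [? ?] [? ?] /=; ring.
Qed.

Lemma inner_lincomb f g h (c : C) : L2 f -> L2 g -> L2 h ->
  inner (fun t => f t + c * g t) h = inner f h + c * inner g h.
Proof.
move=> lf lg lh; have lfg := L2_lincomb c lf lg.
rewrite !innerE//; move: lf lg lh => /L2P[fr fi] /L2P[gr gi] /L2P[hr hi].
have E1 k : J (fun t => Re (f t + c * g t) * k t) =
    J (fun t => (Re (f t) + Re c * Re (g t) + (- Im c) * Im (g t)) * k t).
  by apply: eq_Rintegral => t _; case: (c) (f t) (g t) => [? ?] [? ?] [? ?] /=; ring.
have E2 k : J (fun t => Im (f t + c * g t) * k t) =
    J (fun t => (Im (f t) + Im c * Re (g t) + Re c * Im (g t)) * k t).
  by apply: eq_Rintegral => t _; case: (c) (f t) (g t) => [? ?] [? ?] [? ?] /=; ring.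
rewrite !{}E1 !{}E2 !Rintegral_lincomb//.
by case: c {lfg} => p q; apply/eqP; rewrite eq_complex /=; apply/andP; split; apply/eqP; ring.
Qed.

Lemma inner_conj f g : L2 f -> L2 g -> inner g f = (inner f g)^*.
Proof.
move=> lf lg; rewrite !innerE//=.
have E (u v : R -> R) : J (fun t => u t * v t) = J (fun t => v t * u t).
  by apply: eq_Rintegral => t _; rewrite mulrC.
rewrite (E (fun t => Re (g t))) (E (fun t => Im (g t))) opprB.
by rewrite (E (fun t => Im (g t))) (E (fun t => Re (g t))).
Qed.

Lemma inner_self f : L2 f -> inner f f = (nsq f)%:C.
Proof.
move=> lf; rewrite innerE//; have /L2P[fr fi] := lf.
rewrite /nsq RintegralD//; [|by case: fr|by case: fi].
rewrite [X in _ +i* (X - _)](_ : _ = J (fun t => Re (f t) * Im (f t))).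
  rewrite subrr; congr (_ +i* _); congr (_ + _); apply: eq_Rintegral => t _; exact: expr2.
by apply: eq_Rintegral => t _; rewrite mulrC.
Qed.

Lemma inner0_conj f g : L2 f -> L2 g -> inner f g = 0 -> inner g f = 0.
Proof. by move=> lf lg fg; rewrite inner_conj// fg conjc0. Qed.

(** The common source of the parallelogram bound, Cauchy-Schwarz, Pythagoras and Bessel's inequality
    below. *)
Lemma nsq_lincomb f g (c : C) : L2 f -> L2 g ->
  nsq (fun t => f t + c * g t) =
  nsq f + 2 * Re (c^* * inner f g) + normc c ^+ 2 * nsq g.
Proof.
move=> lf lg; apply: complexI.
rewrite -inner_self; last exact: L2_lincomb.
rewrite inner_lincomb//; last exact: L2_lincomb.
rewrite [inner f _]inner_conj//; last exact: L2_lincomb.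
rewrite [inner g (fun _ => _)]inner_conj//; last exact: L2_lincomb.
rewrite !inner_lincomb// (inner_conj lf lg) !inner_self// normc_sqr.
case: c (inner f g) => p q [x y]; apply/eqP; rewrite eq_complex /=.
by apply/andP; split; apply/eqP; ring.
Qed.

(** The parallelogram law with the term [nsq (f - g)] dropped. It stands in for the triangle
    inequality and avoids square roots, at the cost of a factor 2. *)
Lemma nsqD_le f g : L2 f -> L2 g ->
  nsq (fun t => f t + g t) <= 2 * (nsq f + nsq g).
Proof.
move=> lf lg; have E (c : C) := nsq_lincomb c lf lg.
have := nsq_ge0 (fun t => f t + (-1) * g t); rewrite E.
rewrite (_ : (fun t => f t + g t) = (fun t => f t + 1 * g t)); last first.
  by apply/funext => t; rewrite mul1r.
rewrite E !normc_sqr /=; case: (inner f g) => x y /=.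
lra.
Qed.

Lemma nsq_eq0 f : L2 f -> nsq f = 0 -> f = (fun=> 0) %[ae mu].
Proof.
move=> lf f0; have := L2_nsqE lf; rewrite f0 => i0.
have : ae_eq mu setT (fun t => (Re (f t) ^+ 2 + Im (f t) ^+ 2)%:E) (cst 0%E).
  apply/(ae_eq_integral_abs mu measurableT).
    exact: measurable_int (L2_integrable lf).
  rewrite -[RHS]i0; apply: eq_integral => t _.
  by rewrite /= ger0_norm// addr_ge0 ?sqr_ge0.
apply: filterS => t /(_ I)[] /eqP; rewrite paddr_eq0 ?sqr_ge0// !sqrf_eq0.
by case: (f t) => x y /= /andP[/eqP -> /eqP ->].
Qed.

Lemma eq_ae_inner f g h : L2 f -> L2 g -> L2 h -> f = g %[ae mu] ->
  inner f h = inner g h.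
Proof.
move=> lf lg lh fg.
have E (u v w : measurableTypeR R -> R) : sqint mu u -> sqint mu v -> sqint mu w ->
    u = v %[ae mu] -> J (fun t => u t * w t) = J (fun t => v t * w t).
  move=> su sv sw uv; congr fine; apply: ae_eq_integral => //.
  - exact: measurable_int (sqint_mul su sw).
  - exact: measurable_int (sqint_mul sv sw).
  - by apply: filterS uv => t + _ => ->.
rewrite !innerE//; move: lf lg lh => /L2P[fr fi] /L2P[gr gi] /L2P[hr hi].
have F : Filter (nbhs (almost_everywhere mu : set_system R)) by exact: (ae_filter_ringOfSetsType mu).
have er : (fun t => Re (f t)) = (fun t => Re (g t)) %[ae mu].
  by apply: filterS fg => t /= /[apply] ->.
have ei : (fun t => Im (f t)) = (fun t => Im (g t)) %[ae mu].
  by apply: filterS fg => t /= /[apply] ->.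
by rewrite (E _ _ _ fr gr hr)// (E _ _ _ fr gr hi)// (E _ _ _ fi gi hr)// (E _ _ _ fi gi hi).
Qed.

Lemma cauchy_schwarz f g : L2 f -> L2 g ->
  normc (inner f g) ^+ 2 <= nsq f * nsq g.
Proof.
move=> lf lg; set z := inner f g.
(* Nonnegativity of the squared norm of [f - k z g]. The optimal [k] is the inverse of [nsq g]; the
   case [nsq g = 0] is treated first. *)
have key (k : R) : 0 <= nsq f - 2 * k * normc z ^+ 2 + k ^+ 2 * normc z ^+ 2 * nsq g.
  have := nsq_ge0 (fun t => f t + (- k%:C * z) * g t); rewrite nsq_lincomb// -/z.
  rewrite !normc_sqr; case: z => x y /=; congr (0 <= _); ring.
have := nsq_ge0 f; have := nsq_ge0 g; rewrite le_eqVlt => /predU1P[g0|g0] f0.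
  rewrite -g0 mulr0; have [//|zp] := lerP (normc z ^+ 2) 0.
  (* If [z] were nonzero while [nsq g = 0], this [k] would make the right side of [key] equal to
     -1. *)
  have := key ((nsq f + 1) / (2 * normc z ^+ 2)); rewrite -g0.
  have -> : 2 * ((nsq f + 1) / (2 * normc z ^+ 2)) * normc z ^+ 2 = nsq f + 1.
    by field; move: zp; apply: contraTneq => ->; rewrite expr0n ltxx.
  lra.
have := key (nsq g)^-1.
rewrite (_ : _ + _ * nsq g = (nsq f * nsq g - normc z ^+ 2) / nsq g); last first.
  by field; rewrite gt_eqF.
by rewrite pmulr_lge0 ?invr_gt0// subr_ge0.
Qed.

End SquareIntegrable.

(** * Completeness of L^2 *)

Section Completeness.
Context d (T : measurableType d) (R : realType).
Variable mu : probability T R.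
Local Notation J := (Rintegral mu setT).

Lemma sqintB u v : sqint mu u -> sqint mu v -> sqint mu (fun t => u t - v t).
Proof.
move=> su sv; have := sqint_lincomb (-1) 0 su sv sv; congr sqint.
by apply/funext => t; ring.
Qed.

Lemma sqint_fin u : sqint mu u ->
  (\int[mu]_t (u t ^+ 2)%:E)%E = (J (fun t => u t ^+ 2))%:E.
Proof. by move=> [_ iu]; rewrite /Rintegral fineK//; exact: integrable_fin_num. Qed.

Lemma sqint_norm_le (e : R) u : 0 < e -> sqint mu u ->
  J (fun t => u t ^+ 2) <= e ^+ 2 -> (\int[mu]_t `|u t|%:E <= e%:E)%E.
Proof.
move=> e0 su ue; have [mu_ iu] := su.
(* AM-GM: [|u| <= u^2 / (2 e) + e / 2] *)
have i1 := integrableZl measurableT (2 * e)^-1 iu.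
have i2 : mu.-integrable setT (EFin \o cst (e / 2)).
  exact: finite_measure_integrable_cst.
have := integrableD measurableT i1 i2 => i12.
apply: (@le_trans _ _ (\int[mu]_t ((2 * e)^-1 * (u t ^+ 2) + e / 2)%:E)%E).
  apply: ge0_le_integral => //.
  - by apply/measurable_EFinP; exact: measurableT_comp.
  - exact: measurable_int i12.
  - move=> t _; rewrite lee_fin -subr_ge0.
    rewrite (_ : _ - _ = (`|u t| - e) ^+ 2 / (2 * e)).
      by rewrite divr_ge0 ?sqr_ge0// mulr_ge0// ltW.
    by rewrite -[u t ^+ 2]real_normK ?num_real//; field; rewrite gt_eqF.
under eq_integral do rewrite EFinD EFinM.
rewrite (integralD measurableT i1 i2)/= integralZl// sqint_fin// integral_cst//= probability_setT mule1.
rewrite -EFinM -EFinD lee_fin.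
have eE : e = (2 * e)^-1 * e ^+ 2 + e / 2 by field; rewrite gt_eqF.
by rewrite [leRHS]eE lerD2r// ler_pM2l// invr_gt0 mulr_gt0.
Qed.

Lemma series_norm_bounded_cvg (a : R ^nat) (S : R) :
  (forall n, \sum_(0 <= k < n) `|a k| <= S) -> cvgn (series a).
Proof.
move=> aS; apply: normed_cvg; apply: nondecreasing_is_cvgn.
  by apply: nondecreasing_series => n _ _; exact: normr_ge0.
by exists S => _ [n _ <-]; exact: aS.
Qed.

(** By [sqint_norm_le] the increments have summable L^1 norms, so the sum of their absolute values
    is integrable and hence finite almost everywhere; at such points the telescoping series
    converges absolutely. *)
Lemma fast_cauchy_ae_cvg (v : nat -> T -> R) : (forall n, sqint mu (v n)) ->
  (forall n, J (fun t => (v n.+1 t - v n t) ^+ 2) <= ((2^-1) ^+ n.+1) ^+ 2) ->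
  {ae mu, forall t, cvgn (v^~ t)}.
Proof.
move=> sv dv; pose D n t := (`|v n.+1 t - v n t|%:E : \bar R).
have mD n : measurable_fun setT (D n).
  apply/measurable_EFinP; apply: measurableT_comp => //.
  by case: (sqintB (sv n.+1) (sv n)).
have D0 n t : [set: T] t -> (0 <= D n t)%E by rewrite lee_fin.
have iD : mu.-integrable setT (fun t => (\sum_(n <oo) D n t)%E).
  apply/integrableP; split; first by apply: ge0_emeasurable_sum => // n t tT _; exact: D0.
  under eq_integral => t _.
    rewrite gee0_abs; last by apply: nneseries_ge0 => n _ _; exact: D0.
    over.
  rewrite integral_nneseries//.
  apply: (@le_lt_trans _ _ (\sum_(n <oo) ((2^-1) ^+ n.+1)%:E)%E).
    apply: lee_nneseries => [n _ _|n _].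
      by apply: integral_ge0 => t tT; exact: D0.
    by apply: sqint_norm_le; [rewrite exprn_gt0|exact: sqintB|exact: dv].
  have /cvg_lim := @cvg_geometric_eseries_half R 1 0.
  rewrite (_ : (fun k => (1 / (2 ^ (k + 1))%:R)%:E) = (fun k => ((2^-1) ^+ k.+1)%:E)); last first.
    by apply/funext => k; rewrite addn1 natrX div1r exprVn.
  by move=> ->//; exact: ltry.
have := integrable_ae measurableT iD; apply: filterS => t /(_ I) St.
have : cvgn (series (fun n => v n.+1 t - v n t)).
  apply: (@series_norm_bounded_cvg _ (fine (\sum_(n <oo) D n t)%E)) => n.
  rewrite -lee_fin fineK// -sumEFin.
  exact: nneseries_lim_ge.
have -> : (fun n => v n.+1 t - v n t) = telescope (v^~ t) by [].
rewrite telescopeK => c2; have c1 : cvgn (fun=> v 0%N t) by exact: is_cvg_cst.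
have -> : v^~ t = (fun n => (v n t - v 0%N t) + v 0%N t).
  by apply/funext => n; rewrite subrK.
exact: is_cvgD c2 c1.
Qed.

(** Riesz-Fischer: a rapidly Cauchy subsequence converges almost everywhere, and Fatou's lemma turns
    its pointwise limit into an L^2 limit of the whole sequence. *)
Lemma sqint_complete (u : nat -> T -> R) : (forall n, sqint mu (u n)) ->
  (forall e : R, 0 < e -> exists N, forall m n, (N <= m)%N -> (N <= n)%N ->
    J (fun t => (u m t - u n t) ^+ 2) <= e) ->
  exists2 g, sqint mu g & forall e : R, 0 < e -> exists N, forall n, (N <= n)%N ->
    J (fun t => (u n t - g t) ^+ 2) <= e.
Proof.
move=> su cu.
have [phi phiP] : exists phi : nat -> nat, forall k m n,
    (phi k <= m)%N -> (phi k <= n)%N ->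
    J (fun t => (u m t - u n t) ^+ 2) <= ((2^-1) ^+ k.+1) ^+ 2.
  have cu' k : exists N, forall m n, (N <= m)%N -> (N <= n)%N ->
      J (fun t => (u m t - u n t) ^+ 2) <= ((2^-1) ^+ k.+1) ^+ 2.
    by apply: cu; rewrite !exprn_gt0.
  by have [phi phiP] := choice cu'; exists phi.
(* Summing the [phi j] makes [psi] nondecreasing and keeps it above [phi]; adding [k] makes it tend
   to infinity. *)
pose psi k := (\sum_(j < k.+1) phi j + k)%N.
have phipsi k : (phi k <= psi k)%N by rewrite /psi big_ord_recr /= -addnA addnCA leq_addr.
have psiS k : (psi k <= psi k.+1)%N.
  by rewrite /psi [in X in (_ <= X)%N]big_ord_recr /= leq_add// leq_addr.
have kpsi k : (k <= psi k)%N by rewrite /psi leq_addl.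
pose v k := u (psi k).
have vcvg : {ae mu, forall t, cvgn (v^~ t)}.
  apply: fast_cauchy_ae_cvg => n; first exact: su.
  by apply: phiP => //; exact: leq_trans (psiS n).
(* The upper limit is measurable without any convergence. Where it is infinite, on a null set,
   [fine] gives 0. *)
pose g t := fine (limn_esup (fun k => (v k t)%:E)).
have mg : measurable_fun setT g.
  apply: (measurableT_comp (fine_measurable measurableT)).
  apply: measurable_fun_limn_esup => k; apply/measurable_EFinP.
  by case: (su (psi k)).
have vg : {ae mu, forall t, v^~ t @ \oo --> g t}.
  apply: filterS vcvg => t vt.
  suff -> : g t = limn (v^~ t) by [].
  have /cvg_limn_einf_sup[_ E] : (EFin \o v^~ t) @ \oo --> (limn (v^~ t))%:E.
    by apply: cvg_EFin => //; exact: nearW.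
  by rewrite /g E.
(* Fatou's lemma for [(u m - v k) ^ 2] as [k] grows, with [m] fixed. *)
have bound m e : (exists N, forall n, (N <= n)%N ->
    J (fun t => (u m t - u n t) ^+ 2) <= e) ->
    (\int[mu]_t ((u m t - g t) ^+ 2)%:E <= e%:E)%E.
  move=> [N Ne].
  pose h k t := ((u m t - v k t) ^+ 2)%:E.
  have mh k : measurable_fun setT (h k).
    by have [_ ii] := sqintB (su m) (su (psi k)); exact: measurable_int ii.
  have h0 k t : [set: T] t -> (0 <= h k t)%E by rewrite lee_fin sqr_ge0.
  have := fatou mu measurableT mh h0.
  rewrite (_ : (\int[mu]_t limn_einf (h^~ t))%E =
               (\int[mu]_t ((u m t - g t) ^+ 2)%:E)%E); last first.
    apply: ae_eq_integral => //.
    - rewrite /limn_einf; apply: measurableT_comp; first exact: oppe_measurable.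
      by apply: measurable_fun_limn_esup => k; exact: measurableT_comp.
    - apply/measurable_EFinP; apply: measurable_funX; apply: measurable_funB => //.
      by case: (su m).
    - apply: filterS vg => t vt _.
      have /cvg_limn_einf_sup[-> _]// : h^~ t @ \oo --> ((u m t - g t) ^+ 2)%:E.
      apply: cvg_EFin; first exact: nearW.
      apply: (@cvg_comp _ _ _ _ (fun x => x ^+ 2)); last exact: exprn_continuous.
      by apply: cvgB => //; exact: cvg_cst.
  move=> /le_trans; apply.
  rewrite limn_einf_lim; apply: lime_le; first exact: is_cvg_einfs.
  apply: nearW => n.
  (* The infimum over the tail from [n] is at most its member of index [maxn n N], and there [psi]
     is at least [N]. *)
  apply: (@le_trans _ _ (\int[mu]_t h (maxn n N) t)%E).
    by apply: ereal_inf_lbound; exists (maxn n N) => //=; exact: leq_maxl.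
  rewrite /h (sqint_fin (sqintB (su m) (su _))).
  by rewrite lee_fin Ne// (leq_trans _ (kpsi _))// leq_maxr.
have sug m : sqint mu (fun t => u m t - g t) -> sqint mu g.
  move=> /(sqintB (su m)); congr sqint; apply/funext => t; ring.
have sug' m e : (\int[mu]_t ((u m t - g t) ^+ 2)%:E <= e%:E)%E ->
    sqint mu (fun t => u m t - g t).
  move=> le; have ms : measurable_fun setT (fun t => u m t - g t).
    by apply: measurable_funB => //; case: (su m).
  split=> //; apply/integrableP; split.
    by apply/measurable_EFinP; exact: measurable_funX.
  apply: le_lt_trans (ltry e); apply: le_trans le.
  by under eq_integral do rewrite /= ger0_norm ?sqr_ge0//.
have bnd e : 0 < e -> exists N, forall n, (N <= n)%N ->
    (\int[mu]_t ((u n t - g t) ^+ 2)%:E <= e%:E)%E.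
  move=> /cu[N Ne]; exists N => n Nn; apply: bound; exists N => m; exact: Ne.
exists g.
  have [N /(_ N (leqnn N)) le] := bnd 1 ltr01.
  exact: sug (sug' _ _ le).
move=> e /bnd[N Ne]; exists N => n /Ne le.
by rewrite -lee_fin -sqint_fin//; exact: sug' le.
Qed.
End Completeness.

(** * Orthonormality of the characters *)

Section Characters.
Variable R : realType.
Local Notation C := R[i].
Local Notation mu := (arc_measure R).
Local Notation J := (Rintegral mu setT).
Local Notation Re := complex.Re.
Local Notation Im := complex.Im.

Lemma sqint_bounded (u : measurableTypeR R -> R) (M : R) :
  measurable_fun setT u -> (forall t, `|u t| <= M) -> sqint mu u.
Proof.
move=> mu_ uM; split=> //.
apply: (le_integrable _ _ _ (finite_measure_integrable_cst mu (M ^+ 2) measurableT)) => //.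
  by apply/measurable_EFinP; exact: measurable_funX.
move=> t _; rewrite /= lee_fin !ger0_norm ?sqr_ge0//.
by rewrite -[u t ^+ 2]real_normK ?num_real// ler_sqr ?nnegrE// (le_trans _ (uM t)).
Qed.

Lemma Rintegral_arc_cst (r : R) : J (cst r) = r.
Proof. rewrite (Rintegral_cst mu measurableT).
transitivity (r * fine (1%E : \bar R)); last by rewrite mulr1.
by congr (_ * fine _); exact: probability_setT. Qed.

(** The fundamental theorem of calculus over one period, applied to [1 + phi] with primitive
    [t + F t]; the bound on [phi] makes [1 + phi] nonnegative. *)
Lemma Rintegral_arc_derivative (phi F : R -> R) : continuous phi ->
  (forall t, `|phi t| <= 1) -> (forall t, is_derive t (1 : R) F (phi t)) ->
  F (pi *+ 2) = F 0 -> J phi = 0.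
Proof.
move=> cphi phi1 dF F2pi.
have mphi : measurable_fun setT phi by exact: continuous_measurable_fun.
have iphi : mu.-integrable setT (EFin \o phi).
  apply: (le_integrable _ _ _ (finite_measure_integrable_cst mu 1 measurableT)) => //.
    exact/measurable_EFinP.
  by move=> t _; rewrite /= lee_fin normr1.
have i1 := finite_measure_integrable_cst mu (1 : R) (@measurableT _ (measurableTypeR R)).
have dG (t : R) : is_derive t (1 : R) (fun t => t + F t) (1 + phi t).
  exact: is_deriveD.
have cG : continuous (fun t : R => t + F t).
  move=> t; apply: differentiable_continuous; apply/derivable1_diffP.
  by case: (dG t).
(* [integral_uniform] needs a nonnegative integrand *)
suff : J (fun t => 1 + phi t) = 1.
  by rewrite RintegralD// (Rintegral_arc_cst 1) => /(canRL (addKr _)); rewrite addNr.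
rewrite /Rintegral integral_uniform; last 2 first.
- by apply/measurable_EFinP; exact: measurable_funD.
- by move=> t; rewrite lee_fin; have := phi1 t; rewrite ler_norml => /andP[? _]; lra.
rewrite (@continuous_FTC2 _ _ (fun t => t + F t)).
- by rewrite F2pi subr0 -EFinB -EFinM /= add0r addrK mulVf// gt_eqF// two_pi_gt0.
- exact: two_pi_gt0.
- apply: continuous_subspaceT => t; apply: continuousD; first exact: cst_continuous.
  exact: cphi.
- split.
  + by move=> t _; case: (dG t).
  + by apply: cvg_at_right_filter; exact: cG.
  + by apply: cvg_at_left_filter; exact: cG.
- by move=> t _; rewrite derive1E; case: (dG t).
Qed.

Lemma cexpXE (t : R) n : cexp t ^+ n = cos (n%:R * t) +i* sin (n%:R * t).
Proof.
elim: n => [|n IH]; first by rewrite mul0r cos0 sin0 expr0.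
rewrite exprS IH -natr1 mulrDl mul1r cosD sinD /cexp.
by apply/eqP; rewrite eq_complex /=; apply/andP; split; apply/eqP; ring.
Qed.

Lemma normc_cexpX (t : R) n : normc (cexp t ^+ n) = 1.
Proof. by rewrite cexpXE /= cos2Dsin2 sqrtr1. Qed.

Lemma cexpX_conj (t : R) n : cexp t ^+ n * (cexp t ^+ n)^* = 1.
Proof.
rewrite cexpXE; have := cos2Dsin2 (n%:R * t).
move: (cos _) (sin _) => x y xy.
apply/eqP; rewrite eq_complex /=; apply/andP; split; apply/eqP; last ring.
by rewrite -xy; ring.
Qed.

Let cM (n : nat) : continuous (fun t : R => n%:R * t).
Proof. by move=> t; exact: mulrl_continuous. Qed.

Lemma continuous_cosn n : continuous (fun t : R => cos (n%:R * t)).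
Proof.
by move=> t; apply: continuous_comp; [exact: cM|exact: continuous_cos].
Qed.

Lemma continuous_sinn n : continuous (fun t : R => sin (n%:R * t)).
Proof.
by move=> t; apply: continuous_comp; [exact: cM|exact: continuous_sin].
Qed.

Lemma cexpX_L2 n : L2 (fun t : R => cexp t ^+ n).
Proof.
apply/L2P; split.
- apply: (@sqint_bounded _ 1) => [|t].
    under eq_fun do rewrite cexpXE /=.
    exact: continuous_measurable_fun (@continuous_cosn n).
  rewrite cexpXE /= ler_norml; exact: (introT andP (conj (cos_geN1 _) (cos_le1 _))).
- apply: (@sqint_bounded _ 1) => [|t].
    under eq_fun do rewrite cexpXE /=.
    exact: continuous_measurable_fun (@continuous_sinn n).
  rewrite cexpXE /= ler_norml; exact: (introT andP (conj (sin_geN1 _) (sin_le1 _))).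
Qed.

Let is_derive_muln (n : nat) (t : R) : is_derive t (1 : R) (fun t : R => n%:R * t) n%:R.
Proof.
have := is_deriveZ n%:R (is_derive_id t (1 : R)).
by rewrite /GRing.scale /= mulr1.
Qed.

Let muln2pi (n : nat) : n%:R * (pi *+ 2) = 0 + (pi *+ 2) *+ n :> R.
Proof. by rewrite add0r mulr_natl. Qed.

(** The index is shifted because frequency 0 has integral 1. *)
Lemma Rintegral_cosn n : J (fun t => cos (n.+1%:R * t)) = 0.
Proof.
apply: (@Rintegral_arc_derivative _ (fun t => n.+1%:R^-1 * sin (n.+1%:R * t))).
- exact: continuous_cosn.
- by move=> t; rewrite ler_norml cos_geN1 cos_le1.
- move=> t.
  have -> : cos (n.+1%:R * t) = n.+1%:R^-1 *: (cos (n.+1%:R * t) * n.+1%:R : R).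
    by rewrite /GRing.scale /= mulrCA mulVf ?mulr1// pnatr_eq0.
  apply: is_deriveZ.
  exact: (is_derive1_comp (is_derive_sin _) (is_derive_muln n.+1 t)).
- by rewrite muln2pi mulr0 (periodicn (@sinD2pi R)).
Qed.

Lemma Rintegral_sinn n : J (fun t => sin (n%:R * t)) = 0.
Proof.
case: n => [|n].
  under eq_Rintegral do rewrite mul0r sin0.
  exact: (Rintegral_arc_cst 0).
apply: (@Rintegral_arc_derivative _ (fun t => - n.+1%:R^-1 * cos (n.+1%:R * t))).
- exact: continuous_sinn.
- by move=> t; rewrite ler_norml sin_geN1 sin_le1.
- move=> t.
  have -> : sin (n.+1%:R * t) = (- n.+1%:R^-1) *: (- sin (n.+1%:R * t) * n.+1%:R : R).
    by rewrite /GRing.scale /= !mulNr mulrN opprK mulrCA mulVf ?mulr1// pnatr_eq0.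
  apply: is_deriveZ.
  exact: (is_derive1_comp (is_derive_cos _) (is_derive_muln n.+1 t)).
- by rewrite muln2pi mulr0 (periodicn (@cosD2pi R)).
Qed.

Lemma inner_cexpX m n :
  inner (fun t : R => cexp t ^+ m) (fun t : R => cexp t ^+ n) = (m == n)%:R.
Proof.
(* Conjugate symmetry reduces to [n <= m], where the integrand is the character of natural exponent
   [m - n]. *)
wlog nm : m n / (n <= m)%N => [hw|].
  have [/hw//|/ltnW/hw mn] := leqP n m.
  rewrite inner_conj; [|exact: cexpX_L2|exact: cexpX_L2].
  by rewrite mn eq_sym conjc_nat.
have E t : cexp t ^+ m * (cexp t ^+ n)^* = cexp t ^+ (m - n) :> C.
  by rewrite -{1}(subnK nm) exprD -mulrA cexpX_conj mulr1.
rewrite /inner; under eq_Rintegral do rewrite E cexpXE /=.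
under [X in _ +i* X]eq_Rintegral do rewrite E cexpXE /=.
rewrite Rintegral_sinn eqn_leq nm andbT -subn_eq0; case: (m - n)%N => [|k] /=.
  under eq_Rintegral do rewrite mul0r cos0.
  by rewrite (Rintegral_arc_cst 1).
by rewrite Rintegral_cosn.
Qed.

End Characters.

(** * Power series on the disc *)

Section PowerSeries.
Variable R : realType.
Local Notation C := R[i].
Local Notation mu := (arc_measure R).
Local Notation Re := complex.Re.
Local Notation Im := complex.Im.
Implicit Types (c d : nat -> C) (F : C -> C).

Lemma normcE (z : C) : `|z| = (normc z)%:C.
Proof. by []. Qed.

Lemma normcX (z : C) n : normc (z ^+ n) = normc z ^+ n.
Proof. by elim: n => [|n IH]; [rewrite !expr0 normc1|rewrite !exprS normcM IH]. Qed.

Lemma cvg_complexP (u : nat -> C) (l : C) :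
  (u : nat -> C^o) @ \oo --> (l : C^o) <->
  forall e : R, 0 < e -> exists N, forall n, (N <= n)%N -> normc (l - u n) <= e.
Proof.
split=> [ul e e0|H].
- move/cvgrPdist_le : ul => /(_ e%:C); rewrite ltcR => /(_ e0)[N _ Ne].
  by exists N => n Nn; have := Ne n Nn; rewrite normcE lecR.
(* An epsilon that is positive in [C] has zero imaginary part, so it is a real number. *)
- apply/cvgrPdist_le => -[e e']; rewrite ltcE /= => /andP[/eqP -> e0].
  have [N Ne] := H e e0; exists N => // n Nn.
  by rewrite normcE (lecR _ e); exact: Ne.
Qed.

Definition psum c (z : C) N : C := \sum_(k < N) c k * z ^+ k.

Lemma seriesE_psum c z : series (fun n => c n * z ^+ n) = psum c z.
Proof. by apply/funext => n; rewrite /series /= big_mkord. Qed.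

Lemma psum_tail c z (B q : R) (N j : nat) : 0 <= B -> 0 <= q < 1 ->
  (forall k, normc (c k * z ^+ k) <= B * q ^+ k) ->
  normc (psum c z (N + j) - psum c z N) <= B * q ^+ N / (1 - q).
Proof.
move=> B0 /andP[q0 q1] cB.
(* Keeping the geometric remainder after index [N + j] gives a bound that can be proved by induction
   on [j]. *)
suff H : normc (psum c z (N + j) - psum c z N) <=
    B * q ^+ N / (1 - q) - B * q ^+ (N + j) / (1 - q).
  apply: le_trans H _; rewrite gerBl mulr_ge0 ?mulr_ge0 ?exprn_ge0//.
  by rewrite invr_ge0 subr_ge0 ltW.
elim: j => [|j IH]; first by rewrite addn0 !subrr normc0.
rewrite addnS /psum big_ord_recr /= -/(psum c z (N + j)) addrAC.
apply: le_trans (le_normcD _ _) _; apply: le_trans (lerD IH (cB _)) _.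
rewrite exprS le_eqVlt; apply/orP; left; apply/eqP; field.
by rewrite subr_eq0 gt_eqF.
Qed.

Lemma geometric_small (B q e : R) : 0 <= q < 1 -> 0 < e ->
  exists N0, forall N, (N0 <= N)%N -> B * q ^+ N / (1 - q) <= e.
Proof.
move=> /andP[q0 q1] e0.
have := @cvg_geometric R (B / (1 - q)) q; rewrite ger0_norm// => /(_ q1).
move=> /cvgrPdist_le/(_ e e0)[N0 _ H]; exists N0 => N /H.
by rewrite /= sub0r normrN ler_norml mulrAC => /andP[].
Qed.

Lemma psum_cvg_tail c z F (B q : R) N : 0 <= B -> 0 <= q < 1 ->
  (forall k, normc (c k * z ^+ k) <= B * q ^+ k) ->
  (series (fun n => c n * z ^+ n : C^o) @ \oo --> (F z : C^o)) ->
  normc (F z - psum c z N) <= B * q ^+ N / (1 - q).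
Proof.
move=> B0 q01 cB; rewrite seriesE_psum => /cvg_complexP H.
apply/ler_addgt0Pr => e /H[M HM].
rewrite (_ : _ - _ = (psum c z (N + M) - psum c z N) + (F z - psum c z (N + M))).
  by apply: le_trans (le_normcD _ _) _; apply: lerD; [exact: psum_tail|exact/HM/leq_addl].
by ring.
Qed.

Lemma coef_bound c z (l : C) :
  (series (fun n => c n * z ^+ n : C^o) @ \oo --> (l : C^o)) ->
  exists2 B, 0 <= B & forall k, normc (c k * z ^+ k) <= B.
Proof.
rewrite seriesE_psum => /cvg_complexP /(_ 1 ltr01)[N HN].
(* From [N] on, a term is a difference of two errors of size at most 1, whence 2; an earlier term is
   one of the summands. *)
exists (2 + \sum_(k < N) normc (c k * z ^+ k)).
  by rewrite addr_ge0// sumr_ge0// => k _; exact: normc_ge0.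
move=> k; have [Nk|kN] := leqP N k; last first.
  rewrite (bigD1 (Ordinal kN))//= addrCA lerDl addr_ge0// sumr_ge0// => i _.
  exact: normc_ge0.
have -> : c k * z ^+ k = (l - psum c z k) + - (l - psum c z k.+1).
  by rewrite /psum big_ord_recr /=; ring.
apply: le_trans (le_normcD _ _) _; rewrite normcN.
apply: (@le_trans _ _ (1 + 1)).
  by apply: lerD; apply: HN => //; exact: leq_trans (leqnSn _).
by rewrite -[1 + 1]/(2 : R) lerDl sumr_ge0// => i _; exact: normc_ge0.
Qed.

(** Choose [rho] strictly between [r] and 1. The terms of the series at [rho] are bounded by some
    [B], so those on the circle of radius [r] are bounded by [B * (r / rho) ^+ k], independently of
    [t]. *)
Lemma analytic_disc_unif c F (r : R) :
  (forall z, normc z < 1 -> series (fun n => c n * z ^+ n : C^o) @ \oo --> (F z : C^o)) ->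
  0 <= r < 1 -> forall e : R, 0 < e -> exists N0, forall N t, (N0 <= N)%N ->
  normc (radial F r t - psum (fun k => c k * r%:C ^+ k) (cexp t) N) <= e.
Proof.
move=> cF /andP[r0 r1] e e0; pose rho := (1 + r) / 2.
have rho0 : 0 < rho by rewrite /rho; lra.
have rho1 : rho < 1 by rewrite /rho; lra.
have rrho : r < rho by rewrite /rho; lra.
have nC (x : R) : 0 <= x -> normc x%:C = x.
  by move=> x0; rewrite normcR ger0_norm.
have [B B0 cB] := coef_bound (cF rho%:C ltac:(by rewrite nC// ltW)).
have q01 : 0 <= r / rho < 1.
  by apply/andP; split; [rewrite divr_ge0// ltW|rewrite ltr_pdivrMr// mul1r].
have [N0 HN0] := geometric_small B q01 e0.
exists N0 => N t /HN0; apply: le_trans.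
have n1 : normc (cexp t) = 1 by rewrite -[cexp t]expr1 normc_cexpX.
rewrite (_ : psum _ _ N = psum c (r%:C * cexp t) N); last first.
  by apply: eq_bigr => k _; rewrite exprMn mulrA.
apply: (@psum_cvg_tail c _ F) => //.
  move=> k; rewrite normcM normcX normcM n1 mulr1 nC//.
  have := cB k; rewrite normcM normcX nC ?(ltW rho0)// => cBk.
  rewrite expr_div_n mulrA ler_pdivlMr ?exprn_gt0// mulrAC.
  by rewrite ler_wpM2r// exprn_ge0.
by apply: cF; rewrite normcM n1 mulr1 nC.
Qed.

(** Comparison with a geometric series, for real and imaginary parts separately. *)
Lemma bounded_coef_analytic c (B : R) : (forall k, normc (c k) <= B) ->
  exists F, forall z, normc z < 1 ->
    series (fun n => c n * z ^+ n : C^o) @ \oo --> (F z : C^o).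
Proof.
move=> cB.
have B0 : 0 <= B by apply: le_trans (cB 0%N); exact: normc_ge0.
suff H z : normc z < 1 -> exists l : C,
    series (fun n => c n * z ^+ n : C^o) @ \oo --> (l : C^o).
  (* Choice needs a candidate at every [z]; outside the disc it is 0. *)
  have H' z : exists l : C, normc z < 1 ->
      series (fun n => c n * z ^+ n : C^o) @ \oo --> (l : C^o).
    by have [/H[l lz]|_] := ltP (normc z) 1; [exists l|exists 0].
  by have [F FP] := choice H'; exists F.
move=> z1; have q01 : 0 <= normc z < 1 by rewrite normc_ge0.
have tB k : normc (c k * z ^+ k) <= B * normc z ^+ k.
  by rewrite normcM normcX ler_wpM2r// exprn_ge0 ?normc_ge0.
have sumB n : \sum_(0 <= k < n) B * normc z ^+ k <= B / (1 - normc z).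
  suff -> : \sum_(0 <= k < n) B * normc z ^+ k =
      B / (1 - normc z) - B * normc z ^+ n / (1 - normc z).
    rewrite gerBl mulr_ge0 ?mulr_ge0 ?exprn_ge0 ?normc_ge0//.
    by rewrite invr_ge0 subr_ge0 ltW.
  elim: n => [|n IH]; first by rewrite big_geq// expr0 mulr1 subrr.
  rewrite big_nat_recr//= IH exprS; field.
  by rewrite subr_eq0 gt_eqF.
have cR : cvgn (series (fun k => Re (c k * z ^+ k))).
  apply: (@series_norm_bounded_cvg _ _ (B / (1 - normc z))) => n.
  apply: le_trans (sumB n); apply: ler_sum => k _.
  exact: le_trans (normc_ge_normRe _) (tB k).
have cI : cvgn (series (fun k => Im (c k * z ^+ k))).
  apply: (@series_norm_bounded_cvg _ _ (B / (1 - normc z))) => n.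
  apply: le_trans (sumB n); apply: ler_sum => k _.
  exact: le_trans (normc_ge_normIm _) (tB k).
exists (limn (series (fun k => Re (c k * z ^+ k))) +i* limn (series (fun k => Im (c k * z ^+ k)))).
rewrite seriesE_psum; apply/cvg_complexP => e e0.
have e20 : 0 < e / 2 by rewrite divr_gt0.
have /cvgrPdist_le/(_ _ e20)[N1 _ H1] := cR.
have /cvgrPdist_le/(_ _ e20)[N2 _ H2] := cI.
have psE n : psum c z n = series (fun k => Re (c k * z ^+ k)) n +i* series (fun k => Im (c k * z ^+ k)) n.
  elim: n => [|n IH]; first by rewrite /psum /series /= !big_ord0 !big_geq.
  rewrite /psum big_ord_recr /= -/(psum c z n) IH /series /= !big_nat_recr//=.
  by case: (c n * z ^+ n).
exists (maxn N1 N2) => n; rewrite geq_max => /andP[n1 n2]; rewrite psE.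
have normcRI (x y : R) : normc (x +i* y) <= `|x| + `|y|.
  rewrite (_ : x +i* y = x%:C + (0 +i* y)); last by rewrite /= ; apply/eqP; rewrite eq_complex /= addr0 add0r !eqxx.
  apply: le_trans (le_normcD _ _) _.
  by rewrite /= !expr0n /= addr0 add0r !sqrtr_sqr.
apply: le_trans (normcRI _ _) _.
by rewrite [leRHS]splitr; apply: lerD; [exact: H1|exact: H2].
Qed.

End PowerSeries.

(** * Fourier coefficients *)

Section TrigonometricPolynomials.
Variable R : realType.
Local Notation C := R[i].
Local Notation mu := (arc_measure R).
Local Notation J := (Rintegral mu setT).
Local Notation Re := complex.Re.
Local Notation Im := complex.Im.
Implicit Types (c d : nat -> C) (F : C -> C) (f g h : R -> C).

Lemma L2B f g : L2 f -> L2 g -> L2 (fun t => f t - g t).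
Proof.
move=> lf lg; have := L2_lincomb (-1) lf lg; congr L2.
by apply/funext => t; rewrite mulN1r.
Qed.

Lemma L2D f g : L2 f -> L2 g -> L2 (fun t => f t + g t).
Proof.
move=> lf lg; have := L2_lincomb 1 lf lg; congr L2.
by apply/funext => t; rewrite mul1r.
Qed.

Lemma innerB f g h : L2 f -> L2 g -> L2 h ->
  inner (fun t => f t - g t) h = inner f h - inner g h.
Proof.
move=> lf lg lh; rewrite -[RHS]addr0 -[- inner g h]mulN1r addr0 -inner_lincomb//.
by congr (inner _ _); apply/funext => t; rewrite mulN1r.
Qed.

Lemma innerD f g h : L2 f -> L2 g -> L2 h ->
  inner (fun t => f t + g t) h = inner f h + inner g h.
Proof.
move=> lf lg lh; rewrite -[inner g h]mul1r -inner_lincomb//.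
by congr (inner _ _); apply/funext => t; rewrite mul1r.
Qed.

Lemma nsqB_sym f g : nsq (fun t => f t - g t) = nsq (fun t => g t - f t).
Proof.
apply: eq_Rintegral => t _.
by case: (f t) (g t) => [x y] [x' y'] /=; ring.
Qed.

Lemma nsq_ReIm f : L2 f -> nsq f = J (fun t => Re (f t) ^+ 2) + J (fun t => Im (f t) ^+ 2).
Proof. by move=> /L2P[[_ fr] [_ fi]]; rewrite /nsq RintegralD. Qed.

Lemma nsq_bounded f (M : R) : L2 f -> (forall t, normc (f t) <= M) -> nsq f <= M ^+ 2.
Proof.
move=> lf fM; rewrite -[leRHS](@Rintegral_arc_cst R).
apply: le_Rintegral => //.
- exact: L2_integrable.
- exact: finite_measure_integrable_cst.
- by move=> t _; rewrite -normc_sqr ler_sqr ?nnegrE ?normc_ge0// (le_trans _ (fM t))// normc_ge0.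
Qed.

Lemma L2_complete (u : nat -> R -> C) : (forall n, L2 (u n)) ->
  (forall e : R, 0 < e -> exists N, forall m n, (N <= m)%N -> (N <= n)%N ->
    nsq (fun t => u m t - u n t) <= e) ->
  exists2 g, L2 g & forall e : R, 0 < e -> exists N, forall n, (N <= n)%N ->
    nsq (fun t => u n t - g t) <= e.
Proof.
move=> lu cu.
have ReB (x y : C) : Re (x - y) = Re x - Re y by case: x y => [? ?] [? ?].
have ImB (x y : C) : Im (x - y) = Im x - Im y by case: x y => [? ?] [? ?].
have J0 (v : measurableTypeR R -> R) : 0 <= J (fun t => v t ^+ 2).
  by apply: Rintegral_ge0 => t _; exact: sqr_ge0.
have nE f g : L2 f -> L2 g -> nsq (fun t => f t - g t) =
    J (fun t => (Re (f t) - Re (g t)) ^+ 2) + J (fun t => (Im (f t) - Im (g t)) ^+ 2).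
  move=> lf lg; rewrite nsq_ReIm; last exact: L2B.
  by congr (_ + _); apply: eq_Rintegral => t _; rewrite ?ReB ?ImB.
have [|e e0|gr gr2 grP] := @sqint_complete _ _ _ mu (fun n t => Re (u n t)).
- by move=> n; have /L2P[] := lu n.
- have [N HN] := cu e e0; exists N => m n Nm Nn; apply: le_trans (HN m n Nm Nn).
  by rewrite nE// lerDl.
have [|e e0|gi gi2 giP] := @sqint_complete _ _ _ mu (fun n t => Im (u n t)).
- by move=> n; have /L2P[] := lu n.
- have [N HN] := cu e e0; exists N => m n Nm Nn; apply: le_trans (HN m n Nm Nn).
  by rewrite nE// lerDr.
have lg : L2 (fun t => gr t +i* gi t) by apply/L2P.
exists (fun t => gr t +i* gi t) => // e e0.
have e20 : 0 < e / 2 by rewrite divr_gt0.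
have [N1 H1] := grP _ e20; have [N2 H2] := giP _ e20.
exists (maxn N1 N2) => n; rewrite geq_max => /andP[n1 n2].
by rewrite nE// [leRHS]splitr; apply: lerD; [exact: H1|exact: H2].
Qed.

(** Orthogonality passes to L^2 limits: by Cauchy-Schwarz, the squared modulus of [inner w h] is at
    most [nsq (v - h) * nsq w] when [v] is orthogonal to [w]. *)
Lemma inner0_lim w h : L2 w -> L2 h ->
  (forall e : R, 0 < e -> exists v, [/\ L2 v, inner w v = 0 & nsq (fun t => v t - h t) <= e]) ->
  inner w h = 0.
Proof.
move=> lw lh H; apply: eq0_normc; apply/eqP; rewrite -sqrf_eq0 eq_le sqr_ge0 andbT.
apply/ler_addgt0Pr => e e0; rewrite add0r.
have w0 := nsq_ge0 w.
(* Adding 1 keeps the tolerance well defined when [nsq w = 0]. *)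
have [v [lv wv ve]] := H (e / (nsq w + 1)) ltac:(by rewrite divr_gt0// ltr_wpDl).
have -> : inner w h = - (inner (fun t => v t - h t) w)^*.
  rewrite innerB// (inner0_conj lw lv wv) sub0r (inner_conj lw lh).
  by case: (inner w h) => x y; apply/eqP; rewrite eq_complex /= !opprK !eqxx.
have lvh := L2B lv lh.
have -> (z : C) : normc (- z^*) = normc z.
  by case: z => x y; rewrite /= !sqrrN.
apply: le_trans (cauchy_schwarz lvh lw) _.
apply: le_trans (ler_wpM2r w0 ve) _.
rewrite mulrAC ler_pdivrMr ?ltr_wpDl// ler_pM2l//; lra.
Qed.

(** Frequencies run from 0 to [N - 1]: [N] counts the terms and is not the degree. *)
Definition tpoly c N : R -> C := fun t => psum c (cexp t) N.

Lemma tpolyS c N : tpoly c N.+1 = (fun t => tpoly c N t + c N * cexp t ^+ N).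
Proof. by apply/funext => t; rewrite /tpoly /psum big_ord_recr. Qed.

Lemma cst0_L2 : L2 (fun=> 0 : C).
Proof.
have := L2_lincomb (-1) (@cexpX_L2 R 0) (@cexpX_L2 R 0); congr L2.
by apply/funext => t; rewrite mulN1r subrr.
Qed.

Lemma tpoly0 c : tpoly c 0 = (fun=> 0).
Proof. by apply/funext => t; rewrite /tpoly /psum big_ord0. Qed.

Lemma tpoly_L2 c N : L2 (tpoly c N).
Proof.
elim: N => [|N IH]; first by rewrite tpoly0; exact: cst0_L2.
by rewrite tpolyS; exact: L2_lincomb IH (cexpX_L2 _ _).
Qed.

Lemma inner0l h : L2 h -> inner (fun=> 0) h = 0.
Proof.
move=> lh; have := innerB lh lh lh; rewrite subrr => E; rewrite -[RHS]E.
by congr (inner _ _); apply/funext => t; rewrite subrr.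
Qed.

Lemma inner_tpoly c N h : L2 h ->
  inner (tpoly c N) h = \sum_(k < N) c k * inner (fun t => cexp t ^+ k) h.
Proof.
move=> lh; elim: N => [|N IH]; first by rewrite tpoly0 big_ord0 inner0l.
rewrite tpolyS inner_lincomb//; [|exact: tpoly_L2|exact: cexpX_L2].
by rewrite IH big_ord_recr.
Qed.

Lemma inner_tpoly_cexpX c N n :
  inner (tpoly c N) (fun t => cexp t ^+ n) = if (n < N)%N then c n else 0.
Proof.
rewrite inner_tpoly; last exact: cexpX_L2.
under eq_bigr do rewrite inner_cexpX.
case: ltnP => nN; last first.
  by apply: big1 => k _; rewrite ltn_eqF ?mulr0// (leq_trans _ nN).
rewrite (bigD1 (Ordinal nN))//= eqxx mulr1 big1 ?addr0// => k kn.
by rewrite (_ : (k == n :> nat) = false) ?mulr0//; apply/negbTE.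
Qed.

(** Pythagoras, one frequency at a time: the character of exponent [N] is orthogonal to
    [tpoly c N]. *)
Lemma nsq_tpoly c N : nsq (tpoly c N) = \sum_(k < N) normc (c k) ^+ 2.
Proof.
elim: N => [|N IH].
  rewrite tpoly0 big_ord0; apply: complexI.
  by rewrite -inner_self ?inner0l//; exact: cst0_L2.
rewrite tpolyS nsq_lincomb; [|exact: tpoly_L2|exact: cexpX_L2].
rewrite inner_tpoly_cexpX ltnn mulr0 mulr0 addr0 IH big_ord_recr /=; congr (_ + _).
suff -> : nsq (fun t : R => cexp t ^+ N) = 1 by rewrite mulr1.
apply: complexI; rewrite -inner_self; last exact: cexpX_L2.
by rewrite inner_cexpX eqxx.
Qed.

Definition fourier_coef f (n : nat) : C := inner f (fun t => cexp t ^+ n).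

(** The gap is the squared norm of [f] minus its Fourier sum with [N] terms. *)
Lemma bessel f N : L2 f ->
  \sum_(k < N) normc (fourier_coef f k) ^+ 2 <= nsq f.
Proof.
move=> lf; rewrite -subr_ge0.
suff <- : nsq (fun t => f t - tpoly (fourier_coef f) N t) =
   nsq f - \sum_(k < N) normc (fourier_coef f k) ^+ 2 by exact: nsq_ge0.
have lt := tpoly_L2 (fourier_coef f) N.
have -> : (fun t => f t - tpoly (fourier_coef f) N t) =
          (fun t => f t + (-1) * tpoly (fourier_coef f) N t).
  by apply/funext => t; rewrite mulN1r.
rewrite nsq_lincomb// nsq_tpoly (inner_conj lt lf) inner_tpoly//.
have -> : \sum_(k < N) fourier_coef f k * inner (fun t => cexp t ^+ k) f =
   (\sum_(k < N) normc (fourier_coef f k) ^+ 2)%:C.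
  rewrite raddf_sum; apply: eq_bigr => k _.
  rewrite (inner_conj lf (cexpX_L2 _ k)) -/(fourier_coef f k) normc_sqr.
  by case: (fourier_coef f k) => x y; apply/eqP; rewrite eq_complex /=; apply/andP; split; apply/eqP; ring.
rewrite normc_sqr /=; ring.
Qed.

Lemma nondecreasing_bounded_tail (A : nat -> R) (M : R) :
  (forall n, A n <= A n.+1) -> (forall n, A n <= M) ->
  forall e : R, 0 < e -> exists N, forall n, (N <= n)%N -> A n - A N <= e.
Proof.
move=> Ai AM e e0.
have nd : nondecreasing_seq A by apply/nondecreasing_seqP.
have cA : cvgn A by apply: nondecreasing_is_cvgn => //; exists M => _ [n _ <-].
have /cvgrPdist_le/(_ e e0)[N _ HN] := cA.
exists N => n Nn; have := HN N (leqnn N); have := nondecreasing_cvgn_le nd cA n.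
by rewrite ler_norml => ? /andP[_ ?]; lra.
Qed.

(** Writes the difference of two partial sums as one trigonometric polynomial, so that its norm can
    be read off, and compared, coefficient by coefficient. *)
Definition tail c N (k : nat) : C := if (k < N)%N then 0 else c k.

Lemma tpolyB_tail c M N t : (N <= M)%N ->
  tpoly c M t - tpoly c N t = tpoly (tail c N) M t.
Proof.
elim: M => [|M IH] NM.
  by move: NM; rewrite leqn0 => /eqP ->; rewrite tpoly0 subrr.
rewrite !tpolyS /tail; have [NM'|] := ltnP M N.
  have -> : N = M.+1 by apply/eqP; rewrite eqn_leq NM.
  rewrite tpolyS subrr mul0r addr0 /tpoly /psum big1// => k _.
  by rewrite ltnS ltnW// mul0r.
by move=> /IH <-; rewrite addrAC.
Qed.

Lemma nsq_tail c M N : (N <= M)%N ->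
  nsq (tpoly (tail c N) M) =
  \sum_(k < M) normc (c k) ^+ 2 - \sum_(k < N) normc (c k) ^+ 2.
Proof.
move=> NM; rewrite nsq_tpoly; apply: (canRL (addrK _)).
rewrite (big_ord_widen _ (fun k => normc (c k) ^+ 2) NM) [X in _ + X]big_mkcond/= -big_split/=.
apply: eq_bigr => k _; rewrite /tail; case: ifP => _; last by rewrite addr0.
by rewrite normc0 expr0n add0r.
Qed.

End TrigonometricPolynomials.

(** * The projection onto H^2_+ *)

Section HardySpace.
Variable R : realType.
Local Notation C := R[i].
Local Notation mu := (arc_measure R).
Local Notation Re := complex.Re.
Local Notation Im := complex.Im.
Implicit Types (c d : nat -> C) (F : C -> C) (f g h : R -> C).

(** Trades the extended-real limit of the norm for real bounds on [nsq]. Membership in [L2] is asked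
    only near 1, as dilates are controlled only for [0 <= r < 1]. *)
Lemma cnorm2_cvg0 (G : R -> R -> C) : (\forall r \near (1 : R)^'-, L2 (G r)) ->
  (cnorm 2%:E (G r) @[r --> (1 : R)^'-] --> 0%E <->
   forall e : R, 0 < e -> \forall r \near (1 : R)^'-, nsq (G r) <= e).
Proof.
move=> lG; split=> [/fine_cvgP[_ /cvgrPdist_le H] e e0|H].
- have s0 : 0 < Num.sqrt e by rewrite sqrtr_gt0.
  near=> r.
  have lGr : L2 (G r) by near: r.
  have : `|0 - fine (cnorm 2%:E (G r))| <= Num.sqrt e by near: r; exact: H.
  rewrite (L2_cnormE lGr) /= sub0r normrN ger0_norm ?sqrtr_ge0//.
  by rewrite ler_sqrt// ltW.
- apply/fine_cvgP; split.
    by apply: filterS lG => r lGr; rewrite (L2_cnormE lGr).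
  apply/cvgrPdist_le => e e0; near=> r.
  have lGr : L2 (G r) by near: r.
  have : nsq (G r) <= e ^+ 2 by near: r; apply: H; rewrite exprn_gt0.
  rewrite /= (L2_cnormE lGr) /= sub0r normrN ger0_norm ?sqrtr_ge0//.
  by move=> /ler_wsqrtr; rewrite sqrtr_sqr ger0_norm// ltW.
Unshelve. all: by end_near. Qed.

Definition dilate c (r : R) (k : nat) : C := c k * r%:C ^+ k.

Definition power_series c F := forall z : C, normc z < 1 ->
  series (fun n => c n * z ^+ n : C^o) @ \oo --> (F z : C^o).

(** A dilate is a uniform limit of trigonometric polynomials: measurable as a limit, and bounded
    because it stays within 1 of one of them. *)
Lemma radial_L2 c F (r : R) : power_series c F -> 0 <= r < 1 -> L2 (radial F r).
Proof.
move=> cF r01; have unif := analytic_disc_unif cF r01.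
have mt N := (L2P _).1 (tpoly_L2 (dilate c r) N).
have [N0 HN0] := unif 1 ltr01.
have [M FM] : exists M, forall t, normc (radial F r t) <= M.
  exists (1 + \sum_(k < N0) normc (dilate c r k)) => t.
  rewrite -[radial F r t](subrK (tpoly (dilate c r) N0 t)).
  apply: le_trans (le_normcD _ _) _; apply: lerD; first exact: HN0.
  rewrite /tpoly /psum; elim: N0 {HN0} => [|n IH]; first by rewrite !big_ord0 normc0.
  rewrite !big_ord_recr /=; apply: le_trans (le_normcD _ _) _; apply: lerD => //.
  by rewrite normcM normc_cexpX mulr1.
apply/L2P; split; apply: (@sqint_bounded _ _ M).
- apply: (measurable_fun_cvg (h := fun N t => Re (tpoly (dilate c r) N t))).
    by move=> N; case: (mt N) => -[].
  move=> t _; apply/cvgrPdist_le => e e0; have [N1 HN1] := unif e e0.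
  exists N1 => // N N1N; apply: le_trans (HN1 N t N1N).
  apply: le_trans (normc_ge_normRe _); rewrite /tpoly; move: (radial F r t) (psum _ _ _) => [? ?] [? ?] //=.
- by move=> t; exact: le_trans (normc_ge_normRe _) (FM t).
- apply: (measurable_fun_cvg (h := fun N t => Im (tpoly (dilate c r) N t))).
    by move=> N; case: (mt N) => _ [].
  move=> t _; apply/cvgrPdist_le => e e0; have [N1 HN1] := unif e e0.
  exists N1 => // N N1N; apply: le_trans (HN1 N t N1N).
  apply: le_trans (normc_ge_normIm _); rewrite /tpoly; move: (radial F r t) (psum _ _ _) => [? ?] [? ?] //=.
- by move=> t; exact: le_trans (normc_ge_normIm _) (FM t).
Qed.

Lemma radial_approx c F (r : R) : power_series c F -> 0 <= r < 1 ->
  forall e : R, 0 < e -> exists N0, forall N, (N0 <= N)%N ->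
  nsq (fun t => radial F r t - tpoly (dilate c r) N t) <= e.
Proof.
move=> cF r01 e e0; have lF := radial_L2 cF r01.
have s0 : 0 < Num.sqrt e by rewrite sqrtr_gt0.
have [N0 HN0] := analytic_disc_unif cF r01 s0.
exists N0 => N NN; rewrite -[leRHS]sqr_sqrtr; last exact: ltW.
apply: nsq_bounded; first exact: L2B lF (tpoly_L2 _ _).
by move=> t; exact: HN0.
Qed.

Lemma near_radius : \forall r \near (1 : R)^'-, 0 <= r < 1.
Proof.
near=> r; apply/andP; split; near: r; last exact: nbhs_left_lt.
by apply: nbhs_left_ge; exact: ltr01.
Unshelve. all: by end_near. Qed.

(** Two passages to the limit by [inner0_lim]: from polynomials to dilates, then from dilates to
    boundary values. *)
Lemma orth_Hplus w : L2 w -> (forall n, inner w (fun t => cexp t ^+ n) = 0) ->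
  forall h, Hplus h -> inner w h = 0.
Proof.
move=> lw we h [lh [F [[c cF] _] bF]].
have wF r : 0 <= r < 1 -> inner w (radial F r) = 0.
  move=> r01; have lF := radial_L2 cF r01; apply: inner0_lim => // e e0.
  have [N HN] := radial_approx cF r01 e0.
  exists (tpoly (dilate c r) N); split; first exact: tpoly_L2.
    apply: inner0_conj => //; first exact: tpoly_L2.
    rewrite inner_tpoly//; apply: big1 => k _.
    by rewrite (inner0_conj lw (cexpX_L2 _ _) (we k)) mulr0.
  by rewrite nsqB_sym; exact: HN.
apply: inner0_lim => // e e0.
have lFh : \forall r \near (1 : R)^'-, L2 (fun t => radial F r t - h t).
  by apply: filterS near_radius => r r01; apply: L2B => //; exact: radial_L2 cF r01.
have /(_ e e0) H := (cnorm2_cvg0 lFh).1 bF.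
have [r [r01 rle]] : exists r : R, 0 <= r < 1 /\ nsq (fun t => radial F r t - h t) <= e.
  by have [r [? ?]] := filter_ex (filterI near_radius H); exists r.
by exists (radial F r); split; [exact: radial_L2 cF r01|exact: wF|].
Qed.

Lemma tpolyB c d N t : tpoly c N t - tpoly d N t = tpoly (fun k => c k - d k) N t.
Proof.
rewrite /tpoly /psum -sumrB; apply: eq_bigr => k _; by rewrite mulrBl.
Qed.

(** For fixed [N] the squared norm is a finite sum of terms [normc (c k) ^+ 2 * (r ^+ k - 1) ^+ 2],
    continuous in [r] and vanishing at 1. *)
Lemma dilate_cvg c N :
  nsq (fun t => tpoly (dilate c r) N t - tpoly c N t) @[r --> (1 : R)^'-] --> (0 : R).
Proof.
under eq_fun do under eq_fun do rewrite tpolyB.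
under eq_fun do rewrite nsq_tpoly.
elim: N => [|N IH].
  under eq_fun do rewrite big_ord0.
  exact: cvg_cst.
under eq_fun do rewrite big_ord_recr /=.
have -> : (fun r => \sum_(i < N) normc (dilate c r i - c i) ^+ 2 + normc (dilate c r N - c N) ^+ 2) =
    (fun r : R => \sum_(i < N) normc (dilate c r i - c i) ^+ 2 +
       normc (c N) ^+ 2 * (r ^+ N - 1) ^+ 2).
  apply/funext => r; rewrite /dilate -{2}[c N]mulr1 -mulrBr normcM exprMn.
  by rewrite -rmorphXn -(rmorph1 (real_complex R)) -rmorphB normcR real_normK ?num_real.
suff : (\sum_(i < N) normc (dilate c r i - c i) ^+ 2 +
    normc (c N) ^+ 2 * (r ^+ N - 1) ^+ 2) @[r --> (1 : R)^'-] -->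
    (0 + normc (c N) ^+ 2 * (1 ^+ N - 1) ^+ 2 : R).
  by rewrite expr1n subrr expr0n mulr0 addr0.
apply: (cvgD IH); apply: cvg_at_left_filter; apply: cvgM; first exact: cvg_cst.
apply: (@continuous_comp _ _ _ (fun r : R => r ^+ N - 1) (fun x => x ^+ 2)).
  by apply: continuousB; [exact: exprn_continuous|exact: cst_continuous].
exact: exprn_continuous.
Qed.

(** The coefficient of index [k] is multiplied by [r ^+ k <= 1]. This makes tail estimates uniform
    in [r]. *)
Lemma nsq_dilate_tail c (r : R) N M : 0 <= r < 1 ->
  nsq (tpoly (tail (dilate c r) N) M) <= nsq (tpoly (tail c N) M).
Proof.
move=> /andP[r0 r1]; rewrite !nsq_tpoly; apply: ler_sum => k _.
rewrite /tail; case: ifP => // _; rewrite /dilate normcM normcX normcR exprMn.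
rewrite ler_piMr ?sqr_ge0// exprn_ile1// ?exprn_ge0// exprn_ile1//.
  by rewrite ger0_norm// ltW.
Qed.

Lemma Hplus_projection f : L2 f ->
  exists2 g, Hplus g & forall h, Hplus h -> inner (f \- g) h = 0.
Proof.
move=> lf; pose c := fourier_coef f.
have ctail : forall e : R, 0 < e -> exists N, forall M, (N <= M)%N ->
    nsq (tpoly (tail c N) M) <= e.
  move=> e e0; have [|n|N HN] := @nondecreasing_bounded_tail R
    (fun N => \sum_(k < N) normc (c k) ^+ 2) (nsq f) _ _ e e0.
  - by move=> n; rewrite big_ord_recr lerDl sqr_ge0.
  - exact: bessel.
  - by exists N => M NM; rewrite nsq_tail//; exact: HN.
have [|g lg gP] := L2_complete (tpoly_L2 c).
  (* Going through the partial sum at [N], [nsqD_le] gives [2 * (e / 4 + e / 4) = e]. *)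
  move=> e e0; have [N HN] := ctail (e / 4) ltac:(by rewrite divr_gt0).
  have H m : (N <= m)%N -> nsq (fun t => tpoly c m t - tpoly c N t) <= e / 4.
    by move=> Nm; under eq_fun do rewrite tpolyB_tail//; exact: HN.
  exists N => m n /H Hm /H Hn.
  rewrite (_ : (fun _ => _) = (fun t => (tpoly c m t - tpoly c N t) + (tpoly c N t - tpoly c n t))); last first.
    by apply/funext => t; ring.
  have lt := tpoly_L2 c.
  have := nsqD_le (L2B (lt m) (lt N)) (L2B (lt N) (lt n)).
  rewrite [X in _ <= 2 * (_ + X)]nsqB_sym; lra.
have orth n : inner (fun t => f t - g t) (fun t => cexp t ^+ n) = 0.
  have lfg := L2B lf lg; have len := @cexpX_L2 R n.
  apply: inner0_conj => //; apply: inner0_lim => // e e0.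
  (* Frequency [n] occurs in [tpoly c m] only for [m > n]; from then on [f - tpoly c m] is
     orthogonal to it. *)
  have [N HN] := gP e e0; pose m := maxn N n.+1.
  have lt := tpoly_L2 c m.
  exists (fun t => f t - tpoly c m t); split; first exact: L2B.
    apply: inner0_conj => //; first exact: L2B.
    by rewrite innerB// inner_tpoly_cexpX leq_maxr subrr.
  rewrite (_ : (fun _ => _) = (fun t => g t - tpoly c m t)); last first.
    by apply/funext => t; ring.
  by rewrite nsqB_sym; apply: HN; exact: leq_maxl.
(* A single term of Bessel's inequality; bounded coefficients make the power series converge in the
   disc. *)
have cB k : normc (c k) <= Num.sqrt (nsq f).
  rewrite -[leLHS]ger0_norm ?normc_ge0// -sqrtr_sqr ler_wsqrtr//.
  apply: le_trans (bessel k.+1 lf).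
  by rewrite big_ord_recr /= lerDr sumr_ge0// => i _; exact: sqr_ge0.
have [F cF] := bounded_coef_analytic cB.
exists g; last exact: orth_Hplus (L2B lf lg) orth.
have lF r : 0 <= r < 1 -> L2 (radial F r) := @radial_L2 c F r cF.
split=> //; exists F.
  split; first by exists c.
  (* By [nsqD_le]: a dilate is at squared distance at most 1 from a dilated partial sum, whose
     squared norm is at most [nsq f] by Bessel. *)
  exists (Num.sqrt (2 * (1 + nsq f))) => r r01.
  rewrite L2_cnormE; last exact: lF.
  rewrite lee_fin ler_wsqrtr//.
  have [N HN] := radial_approx cF r01 ltr01.
  rewrite (_ : radial F r = (fun t => (radial F r t - tpoly (dilate c r) N t) + tpoly (dilate c r) N t)); last first.
    by apply/funext => t; rewrite subrK.
  have lt := tpoly_L2 (dilate c r) N.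
  apply: le_trans (nsqD_le (L2B (lF r r01) lt) lt) _.
  rewrite ler_pM2l//; apply: lerD; first exact: HN.
  apply: le_trans (bessel N lf); rewrite -/c -nsq_tpoly.
  have E d : tail d 0 = d by apply/funext.
  by rewrite -(E (dilate c r)) -(E c); exact: nsq_dilate_tail.
apply/cnorm2_cvg0.
  by apply: filterS near_radius => r r01; apply: L2B => //; exact: lF.
(* The difference splits into four pieces; two layers of [nsqD_le] multiply their common bound by
   16. The index [N] is fixed before [r], so that [dilate_cvg] applies, while [M] depends on [r]. *)
move=> e e0; have e16 : 0 < e / 16 by rewrite divr_gt0.
have [N1 HN1] := ctail _ e16; have [N2 HN2] := gP _ e16.
pose N := maxn N1 N2.
have HN M : (N <= M)%N -> nsq (tpoly (tail c N) M) <= e / 16.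
  move=> NM; apply: le_trans (HN1 M (leq_trans (leq_maxl _ _) NM)).
  rewrite !nsq_tpoly; apply: ler_sum => k _; rewrite /tail.
  case: (ltnP k N) => kN; first by rewrite normc0 expr0n sqr_ge0.
  by rewrite ltnNge (leq_trans (leq_maxl _ _) kN).
near=> r; have r01 : 0 <= r < 1 by near: r; exact: near_radius.
have [N3 HN3] := radial_approx cF r01 e16; pose M := maxn N N3.
have [lFr lM lrN lN] := And4 (lF r r01) (tpoly_L2 (dilate c r) M) (tpoly_L2 (dilate c r) N) (tpoly_L2 c N).
have n1 := HN3 M (leq_maxr _ _).
have n2 : nsq (fun t => tpoly (dilate c r) M t - tpoly (dilate c r) N t) <= e / 16.
  under eq_fun do rewrite tpolyB_tail ?leq_maxl//.
  by apply: le_trans (nsq_dilate_tail _ _ _ r01) _; apply: HN; exact: leq_maxl.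
have n3 : nsq (fun t => tpoly (dilate c r) N t - tpoly c N t) <= e / 16.
  near: r; have /cvgrPdist_le/(_ _ e16) := dilate_cvg c N.
  apply: filterS => r; rewrite sub0r normrN; apply: le_trans; exact: ler_norm.
have n4 := HN2 N (leq_maxr _ _).
rewrite (_ : (fun _ => _) = (fun t =>
  ((radial F r t - tpoly (dilate c r) M t) + (tpoly (dilate c r) M t - tpoly (dilate c r) N t)) +
  ((tpoly (dilate c r) N t - tpoly c N t) + (tpoly c N t - g t)))); last first.
  by apply/funext => t; ring.
have l1 := L2B lFr lM; have l2 := L2B lM lrN; have l3 := L2B lrN lN; have l4 := L2B lN lg.
have := nsqD_le (L2D l1 l2) (L2D l3 l4).
have := nsqD_le l1 l2; have := nsqD_le l3 l4; lra.
Unshelve. all: by end_near. Qed.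

End HardySpace.

(** * Kernels *)

Section Projections.
Variable R : realType.
Local Notation C := R[i].
Local Notation mu := (arc_measure R).
Local Notation Re := complex.Re.
Local Notation Im := complex.Im.
Implicit Types (a b eta f g h u v : R -> C) (V : set (R -> C)).

#[local] Instance ae_arc_filter : Filter (nbhs (almost_everywhere mu : set_system R)).
Proof. exact: (ae_filter_ringOfSetsType mu). Qed.

Lemma Linfty_bounded a : Linfty a -> exists M : R, {ae mu, forall t, normc (a t) <= M}.
Proof.
move=> [_ _]; rewrite /cnorm unlock.
(* The infinity norm is an essential supremum only for a measure of positive total mass. *)
have -> : (0 < mu [set: measurableTypeR R])%E.
  by rewrite (_ : mu setT = 1%E)//; exact: probability_setT.
rewrite (_ : abse \o _ = EFin \o (fun t => normc (a t))); last first.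
  by apply/funext => t; rewrite /= ger0_norm ?normc_ge0.
exact: ess_supr_bounded.
Qed.

Lemma Linfty_mul_L2 a f : Linfty a -> L2 f -> L2 (a \* f).
Proof.
move=> la lf; have [M aM] := Linfty_bounded la.
have [mar mai _] := la; have [mfr mfi _] := lf.
have mr : measurable_fun [set: measurableTypeR R] (fun t => Re ((a \* f) t)).
  rewrite (_ : (fun _ => _) = (fun t => Re (a t) * Re (f t) - Im (a t) * Im (f t))).
    by apply: measurable_funB; exact: measurable_funM.
  by apply/funext => t /=; case: (a t) (f t) => [? ?] [? ?].
have mi : measurable_fun [set: measurableTypeR R] (fun t => Im ((a \* f) t)).
  rewrite (_ : (fun _ => _) = (fun t => Re (a t) * Im (f t) + Im (a t) * Re (f t))).
    by apply: measurable_funD; exact: measurable_funM.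
  by apply/funext => t /=; case: (a t) (f t) => [? ?] [? ?].
have msq g : measurable_fun [set: measurableTypeR R] (fun t => Re (g t)) ->
    measurable_fun [set: measurableTypeR R] (fun t => Im (g t)) ->
    measurable_fun [set: measurableTypeR R] (fun t => (Re (g t) ^+ 2 + Im (g t) ^+ 2)%:E).
  by move=> ? ?; apply/measurable_EFinP; apply: measurable_funD; exact: measurable_funX.
split=> //; rewrite -/(cnorm _ _) cnorm2E poweR_lty//.
apply: (@le_lt_trans _ _ (\int[mu]_t ((M ^+ 2)%:E * (Re (f t) ^+ 2 + Im (f t) ^+ 2)%:E))%E).
  apply: ae_ge0_le_integral => //.
  - by move=> t _; rewrite lee_fin addr_ge0 ?sqr_ge0.
  - exact: msq.
  - by move=> t _; rewrite -EFinM lee_fin mulr_ge0 ?addr_ge0 ?sqr_ge0.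
  - by apply: measurable_funeM; exact: msq.
  - apply: filterS aM => t aM _; rewrite -EFinM lee_fin -!normc_sqr normcM exprMn.
    by rewrite ler_wpM2r ?sqr_ge0// ler_sqr ?nnegrE ?normc_ge0// (le_trans _ aM)// normc_ge0.
by rewrite integralZl ?L2_nsqE//; [rewrite -EFinM ltry|exact: L2_integrable].
Qed.

Lemma inner_self_ae0 f : L2 f -> inner f f = 0 -> f = (fun=> 0) %[ae mu].
Proof. by move=> lf; rewrite inner_self// => -[/nsq_eq0]; exact. Qed.

Lemma inner_ae0 f h : L2 f -> L2 h -> f = (fun=> 0) %[ae mu] -> inner f h = 0.
Proof. by move=> lf lh f0; rewrite (eq_ae_inner lf (cst0_L2 R) lh f0) inner0l. Qed.

(** The existence of a projection ensures that [xget] does not return its default. If [f] is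
    orthogonal to [V], the projection [p] satisfies [inner p p = inner f p = 0]. *)
Lemma orthproj_ae0P V f : V `<=` @L2 R -> L2 f ->
  (exists2 g, V g & forall h, V h -> inner (f \- g) h = 0) ->
  orthproj V f = (fun=> 0) %[ae mu] <-> forall h, V h -> inner f h = 0.
Proof.
move=> VL lf [g Vg fg].
have [Vp fp] : V (orthproj V f) /\ forall h, V h -> inner (f \- orthproj V f) h = 0.
  exact: (@xgetPex _ (fun=> 0) [set g | V g /\ forall h, V h -> inner (f \- g) h = 0]
    (ex_intro _ g (conj Vg fg))).
have lp := VL _ Vp; split=> [p0 h Vh|fV].
  by have := fp h Vh; have lh := VL _ Vh; rewrite innerB// (inner_ae0 lp lh p0) subr0.
apply: inner_self_ae0 => //.
by have := fp _ Vp; rewrite innerB// fV// sub0r => /eqP; rewrite oppr_eq0 => /eqP.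
Qed.

Lemma Hplus_L2 : @Hplus R `<=` @L2 R. Proof. by move=> f []. Qed.
Lemma Hminus_L2 : @Hminus R `<=` @L2 R. Proof. by move=> f []. Qed.

Lemma Hplus_orth u v : Hplus u -> Hminus v -> inner u v = 0.
Proof. by move=> hu [lv vP]; apply: inner0_conj => //; [exact: Hplus_L2|exact: vP]. Qed.

Lemma PplusP f : L2 f ->
  Hplus (Pplus f) /\ forall h, Hplus h -> inner (f \- Pplus f) h = 0.
Proof.
by move=> /Hplus_projection[g Hg fg]; exact: (@xgetPex _ (fun=> 0)
  [set g | Hplus g /\ forall h, Hplus h -> inner (f \- g) h = 0] (ex_intro _ g (conj Hg fg))).
Qed.

(** The residual [f - Pplus f] lies in [Hminus], and what it leaves of [f] is in [Hplus]. *)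
Lemma Hminus_projection f : L2 f ->
  exists2 g, Hminus g & forall h, Hminus h -> inner (f \- g) h = 0.
Proof.
move=> lf; have [Hp fp] := PplusP lf; have lp := Hplus_L2 Hp.
exists (f \- Pplus f); first by split; [exact: L2B|exact: fp].
move=> h hh; rewrite (_ : f \- _ = Pplus f); first exact: Hplus_orth.
by apply/funext => t /=; rewrite subKr.
Qed.

Lemma PminusP f : L2 f ->
  Hminus (Pminus f) /\ forall h, Hminus h -> inner (f \- Pminus f) h = 0.
Proof.
by move=> /Hminus_projection[g Hg fg]; exact: (@xgetPex _ (fun=> 0)
  [set g | Hminus g /\ forall h, Hminus h -> inner (f \- g) h = 0] (ex_intro _ g (conj Hg fg))).
Qed.

Lemma Pplus_ae0P f : L2 f -> Pplus f = (fun=> 0) %[ae mu] <-> Hminus f.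
Proof.
move=> lf; have [H1 H2] := orthproj_ae0P Hplus_L2 lf (Hplus_projection lf).
by split=> [/H1//|[_ /H2]].
Qed.

Lemma Pminus_ae0P f : L2 f ->
  Pminus f = (fun=> 0) %[ae mu] <-> forall h, Hminus h -> inner f h = 0.
Proof. by move=> lf; exact: (orthproj_ae0P Hminus_L2 lf (Hminus_projection lf)). Qed.

Lemma HminusB f g : Hminus f -> Hminus g -> Hminus (f \- g).
Proof.
move=> [lf Hf] [lg Hg]; split=> [|h hh]; first exact: L2B.
by have lh := Hplus_L2 hh; rewrite innerB// Hf// Hg// subrr.
Qed.

Lemma ae_eqB0 f g : f \- g = (fun=> 0) %[ae mu] -> f = g %[ae mu].
Proof. by apply: filterS => t /= fg /fg /eqP; rewrite subr_eq0 => /eqP. Qed.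

Lemma eq_ae_Hminus f g : L2 g -> f = g %[ae mu] -> Hminus f -> Hminus g.
Proof.
move=> lg fg [lf Hf]; split=> // h hh.
by rewrite -(eq_ae_inner lf lg (Hplus_L2 hh) fg) Hf.
Qed.

(** The component [u] is described by orthogonality to [Hminus], because this is what the vanishing
    of [hankel eta u] says about [eta \* u]. *)
Lemma projections_unique f u v : L2 f -> L2 u -> (forall h, Hminus h -> inner u h = 0) ->
  Hminus v -> f = u \+ v %[ae mu] ->
  Pplus f = u %[ae mu] /\ Pminus f = v %[ae mu].
Proof.
move=> lf lu uH Hv fuv; have lv := Hminus_L2 Hv.
have [Hp fp] := PplusP lf; have lp := Hplus_L2 Hp.
have [Hq fq] := PminusP lf; have lq := Hminus_L2 Hq.
have lfp : L2 (f \- Pplus f) by exact: L2B.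
(* Almost everywhere it equals [v - (f - Pplus f)], a difference of elements of [Hminus]. Being also
   orthogonal to [Hminus], it vanishes. *)
have Hpu : Hminus (Pplus f \- u).
  apply: (@eq_ae_Hminus (v \- (f \- Pplus f))).
  - exact: L2B.
  - by apply: filterS fuv => t /= /[apply] ->; ring.
  - by apply: HminusB => //; split.
split; apply: ae_eqB0; apply: inner_self_ae0; try exact: L2B.
- have lpu := Hminus_L2 Hpu; rewrite {1}innerB// uH// subr0.
  exact: Hplus_orth.
- have Hqv := HminusB Hq Hv; have lqv := Hminus_L2 Hqv.
  have lfq : L2 (f \- Pminus f) by exact: L2B.
  (* This form of [Pminus f - v] shows that it is orthogonal to [Hminus], to which it belongs. *)
  rewrite (@eq_ae_inner _ _ (u \- (f \- Pminus f)))//.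
  + by rewrite innerB// uH// fq// subrr.
  + exact: L2B.
  + by apply: filterS fuv => t /= /[apply] ->; ring.
Qed.

(** * Stability of the kernels under multiplication *)

(** Stated for any almost everywhere decomposition [u \+ v], so as to cover both the direct-sum form
    and the form with [Pplus f] and [Pminus f]. *)
Lemma kerS_mul a b eta f u v : Linfty eta -> kerS a b f ->
  Hplus u -> hankel eta u = (fun=> 0) %[ae mu] ->
  Hminus v -> hankelt eta v = (fun=> 0) %[ae mu] ->
  f = u \+ v %[ae mu] -> kerS a b (eta \* f).
Proof.
move=> leta [lf Sf] Hu hu Hv hv fuv.
have lu := Hplus_L2 Hu; have lv := Hminus_L2 Hv.
have lef := Linfty_mul_L2 leta lf; have leu := Linfty_mul_L2 leta lu.
have lev := Linfty_mul_L2 leta lv.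
have [pf qf] := projections_unique lf lu (fun h => Hplus_orth Hu) Hv fuv.
have [|pef qef] := projections_unique lef leu ((Pminus_ae0P leu).1 hu) ((Pplus_ae0P lev).1 hv).
  by apply: filterS fuv => t /= /[apply] ->; rewrite mulrDr.
split; first exact: lef.
near=> t => tT.
have Sft : a t * Pplus f t + b t * Pminus f t = 0 by move: tT; near: t.
have pft : Pplus f t = u t by move: tT; near: t.
have qft : Pminus f t = v t by move: tT; near: t.
have peft : Pplus (eta \* f) t = eta t * u t by move: tT; near: t.
have qeft : Pminus (eta \* f) t = eta t * v t by move: tT; near: t.
move: Sft; rewrite /Sop /= pft qft peft qeft => E.
by rewrite [RHS](_ : 0 = eta t * (a t * u t + b t * v t)); [ring|rewrite E mulr0].
Unshelve. all: by end_near. Qed.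

Lemma kerSigma_mul a b eta f : Linfty a -> Linfty b -> Linfty eta ->
  kerSigma a b f -> sumL2 (kerH eta) (kerHt eta) ((a \- b) \* f) ->
  kerSigma a b (eta \* f).
Proof.
move=> la lb leta [lf Sf] [_ [u [v [[Hu hu] [Hv hv] abuv]]]].
have lu := Hplus_L2 Hu; have lv := Hminus_L2 Hv.
have laf := Linfty_mul_L2 la lf; have lbf := Linfty_mul_L2 lb lf.
have lef := Linfty_mul_L2 leta lf.
have laef := Linfty_mul_L2 la lef; have lbef := Linfty_mul_L2 lb lef.
have leu := Linfty_mul_L2 leta lu; have lev := Linfty_mul_L2 leta lv.
have [Hp _] := PplusP laf; have lp := Hplus_L2 Hp.
have [Hq _] := PminusP lbf; have lq := Hminus_L2 Hq.
have lpq : L2 (Pplus (a \* f) \+ Pminus (b \* f)) by exact: L2D.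
(* Pairing the kernel equation with [Pplus (a \* f)] removes the [Hminus] summand, so this
   projection has norm 0. *)
have Haf : Hminus (a \* f).
  apply/Pplus_ae0P => //; apply: inner_self_ae0 => //.
  have := inner_ae0 lpq lp Sf; rewrite innerD// => <-.
  by case: Hq => _ ->//; rewrite addr0.
have Hbf : forall h, Hminus h -> inner (b \* f) h = 0.
  apply/Pminus_ae0P => //; apply: inner_self_ae0 => //.
  by have := inner_ae0 lpq lq Sf; rewrite innerD// (Hplus_orth Hp Hq) add0r.
have Hw := HminusB Haf Hv; have lw := Hminus_L2 Hw.
have wE : (a \* f) \- v = (b \* f) \+ u %[ae mu].
  apply: filterS abuv => t /= /[apply]; rewrite mulrBl => E.
  by rewrite -[a t * f t](subrK (b t * f t)) E; ring.
(* The left form lies in [Hminus] and the right form [b f + u] is orthogonal to it. Hence [a f = v]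
   and [b f = - u] almost everywhere. *)
have w0 : (a \* f) \- v = (fun=> 0) %[ae mu].
  apply: inner_self_ae0 => //; rewrite (eq_ae_inner lw (L2D lbf lu) lw wE).
  by rewrite innerD// Hbf// (Hplus_orth Hu Hw) addr0.
have p0 : Pplus (a \* (eta \* f)) = (fun=> 0) %[ae mu].
  apply/Pplus_ae0P => //; apply: (eq_ae_Hminus laef _ ((Pplus_ae0P lev).1 hv)).
  apply: filterS w0 => t /= /[apply] /eqP; rewrite subr_eq0 => /eqP <-; ring.
(* Here [b eta f = - eta u], and [eta u] is orthogonal to [Hminus]. *)
have q0 : Pminus (b \* (eta \* f)) = (fun=> 0) %[ae mu].
  apply/Pminus_ae0P => // h Hh; have lh := Hminus_L2 Hh.
  have := (Pminus_ae0P leu).1 hu h Hh => uh.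
  rewrite (@eq_ae_inner _ _ ((fun=> 0) \- (eta \* u)))//.
  + by rewrite (innerB (cst0_L2 R) leu lh) inner0l// uh subrr.
  + by apply: L2B => //; exact: cst0_L2.
  + near=> t => tT.
    have E1 : a t * f t - v t = b t * f t + u t by move: tT; near: t.
    have E2 : a t * f t - v t = 0 by move: tT; near: t.
    have /eqP : b t * f t + u t = 0 by rewrite -E1.
    by rewrite addr_eq0 => /eqP E /=; rewrite mulrCA E; ring.
split; first exact: lef.
near=> t => tT; rewrite /Sigmaop /=.
have -> : Pplus (a \* (eta \* f)) t = 0 by move: tT; near: t.
have -> : Pminus (b \* (eta \* f)) t = 0 by move: tT; near: t.
by rewrite addr0.
Unshelve. all: by end_near. Qed.

Lemma L2_decomposition f : L2 f -> f = Pplus f \+ Pminus f %[ae mu].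
Proof.
move=> lf; have [Hp fp] := PplusP lf; have lp := Hplus_L2 Hp.
have Hm : Hminus (f \- Pplus f) by split; [exact: L2B|exact: fp].
have [_ q] := projections_unique lf lp (fun h => Hplus_orth Hp) Hm
  (filterS (fun t => fun _ _ => esym (subrKC (Pplus f t) (f t))) filterT).
by apply: filterS q => t /= /[apply] ->; rewrite subrKC.
Qed.

End Projections.

Theorem proposition5p12 (R : realType) (a b eta : R -> R[i])
    (aLinfty : Linfty a) (bLinfty : Linfty b) (ab : symbol_pair a b)
    (etaLinfty : Linfty eta) :
  (stable_in (kerS a b) (kerS a b `&` sumL2 (kerH eta) (kerHt eta))
     (fun f => eta \* f) /\
   (forall f : R -> R[i], kerS a b f ->
      hankel eta (Pplus f) = (fun=> 0) %[ae arc_measure R] ->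
      hankelt eta (Pminus f) = (fun=> 0) %[ae arc_measure R] ->
      kerS a b (eta \* f))) /\
  (forall f : R -> R[i], kerSigma a b f ->
     sumL2 (kerH eta) (kerHt eta) ((a \- b) \* f) ->
     kerSigma a b (eta \* f)).
Proof.
split; [split; [split|]|].
- by move=> f [].
- move=> _ [f [Sf [_ [u [v [[Hu hu] [Hv hv] fuv]]]]] <-].
  exact: kerS_mul Sf Hu hu Hv hv fuv.
- move=> f Sf hu hv; have lf := Sf.1.
  exact: kerS_mul Sf (PplusP lf).1 hu (PminusP lf).1 hv (L2_decomposition lf).
- by move=> f; exact: kerSigma_mul.
Qed.
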